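(* Let $\overline{M}\times_F\widetilde{N}$ be the warped product of a $2$-dimensional semi-Riemannian manifold $(\overline{M},\overline{g})$ and an $(n-2)$-dimensional semi-Riemannian manifold $(\widetilde{N},\widetilde{g})$, $n\geq4$, with warping function $F$, and assume that $(\widetilde{N},\widetilde{g})$ is a space of constant curvature if $n\geq5$ (no assumption on $(\widetilde N,\widetilde g)$ if $n=4$). Let $U\subset{\mathcal U}_S\cap{\mathcal U}_C\subset\overline{M}\times_F\widetilde{N}$ be a coordinate domain of a point $x\in{\mathcal U}_S\cap{\mathcal U}_C$. Then $\overline{M}\times_F\widetilde{N}$ satisfies $R\cdot R=L_R\,Q(g,R)$ on $U$, for some function $L_R$, if and only if on $U$ $$H=\frac12\,T+FL_R\,\overline{g}=\frac12\,T+F\Big(-\frac{\mathrm{tr}\,T}{4F}\Big)\overline{g}=\frac12\Big(T-\frac{\mathrm{tr}\,T}2\,\overline{g}\Big)=0\qquad\text{with }L_R=-\frac{\mathrm{tr}\,T}{4F},$$ i.e. if and only if $T_{ab}$ is proportional to $\overline{g}_{ab}$ on $U$.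
   Context: All manifolds are connected, paracompact and of class $C^\infty$. For a semi-Riemannian manifold $(M,g)$, $n=\dim M$, with Levi-Civita connection $\nabla$: ${\mathcal R}(X,Y)Z=\nabla_X\nabla_YZ-\nabla_Y\nabla_XZ-\nabla_{[X,Y]}Z$, $R(X_1,X_2,X_3,X_4)=g({\mathcal R}(X_1,X_2)X_3,X_4)$, $S(X,Y)=\mathrm{tr}\{Z\mapsto{\mathcal R}(Z,X)Y\}$, $\kappa$ the scalar curvature, $C$ the Weyl conformal curvature tensor. $(R\cdot R)(X_1,\dots,X_4,X,Y)=-\sum_iR(X_1,\dots,{\mathcal R}(X,Y)X_i,\dots,X_4)$ and $Q(g,R)(X_1,\dots,X_4,X,Y)=-\sum_iR(X_1,\dots,(X\wedge_gY)X_i,\dots,X_4)$, where $(X\wedge_gY)Z=g(Y,Z)X-g(X,Z)Y$. ${\mathcal U}_S$ is the set of points where $S\ne\frac\kappa ng$; ${\mathcal U}_C$ is the set of points where $C\neq0$. Warped product: $F$ is a positive smooth function on $\overline M$ and $g=\pi_1^*\overline g+(F\circ\pi_1)\,\pi_2^*\widetilde g$ on $\overline M\times\widetilde N$. In product charts, indices $a,b\in\{1,2\}$ refer to $\overline M$; $T$ is the $(0,2)$-tensor with components $T_{ab}=\overline\nabla_aF_b-\frac1{2F}F_aF_b$, $F_a=\partial_aF$, and $\mathrm{tr}\,T=\overline g^{ab}T_{ab}$; $H_{ab}=\frac12T_{ab}+FL_R\,\overline g_{ab}$. *)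

(* Defs.v *)
From HB Require Import structures.
From mathcomp Require Import all_boot all_order all_algebra.
From mathcomp Require Import all_classical all_reals all_analysis.
Set Implicit Arguments.
Unset Strict Implicit.
Unset Printing Implicit Defensive.
Import Order.TTheory GRing.Theory Num.Theory.
Import numFieldNormedType.Exports.
Local Open Scope classical_set_scope.
Local Open Scope ring_scope.

Definition partial (R : realType) (d : nat) (i : 'I_d) (f : 'rV[R]_d -> R)
    (x : 'rV[R]_d) : R :=
  'D_(delta_mx 0 i) f x.

(* For an open D this is C^oo: every iterated partial derivative exists and is
   differentiable (hence continuous) at every point of D. *)
Definition smooth_on (R : realType) (d : nat) (D : set 'rV[R]_d)
    (f : 'rV[R]_d -> R) : Prop :=
  forall (s : seq 'I_d) (x : 'rV[R]_d), D x ->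
    differentiable (foldr (@partial R d) f s) x.

Definition smooth_map_on (R : realType) (d e : nat) (D : set 'rV[R]_d)
    (f : 'rV[R]_d -> 'rV[R]_e) : Prop :=
  forall j : 'I_e, smooth_on D (fun x => f x 0 j).

Definition locally_finite (T : topologicalType) (V : set (set T)) : Prop :=
  forall x : T, exists2 W : set T,
    nbhs x W & finite_set [set A | V A /\ A `&` W !=set0].

Definition paracompact (T : topologicalType) : Prop :=
  forall V : set (set T),
    (forall A, V A -> open A) -> \bigcup_(A in V) A = [set: T] ->
  exists W : set (set T),
    [/\ forall A, W A -> open A,
        \bigcup_(A in W) A = [set: T],
        forall A, W A -> exists2 B, V B & A `<=` B
      & locally_finite W].

(* Raw charts; [cmap] is only meaningful on [cdom], and [cinv], the inverse of
   [cmap], only on [cimg]. *)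
Record chart (R : realType) (T : topologicalType) (d : nat) := Chart {
  cdom : set T;
  cmap : T -> 'rV[R]_d;
  cinv : 'rV[R]_d -> T }.

Definition cimg (R : realType) (T : topologicalType) (d : nat)
    (c : chart R T d) : set 'rV[R]_d :=
  cmap c @` cdom c.

Definition is_chart (R : realType) (T : topologicalType) (d : nat)
    (c : chart R T d) : Prop :=
  [/\ open (cdom c), open (cimg c),
      forall p, cdom c p -> cinv c (cmap c p) = p,
      {within cdom c, continuous (cmap c)}
    & {within cimg c, continuous (cinv c)}].

Definition overlap (R : realType) (T : topologicalType) (d : nat)
    (c c' : chart R T d) : set 'rV[R]_d :=
  cmap c @` (cdom c `&` cdom c').

Definition transition (R : realType) (T : topologicalType) (d : nat)
    (c c' : chart R T d) (x : 'rV[R]_d) : 'rV[R]_d :=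
  cmap c' (cinv c x).

Definition compatible (R : realType) (T : topologicalType) (d : nat)
    (c c' : chart R T d) : Prop :=
  smooth_map_on (overlap c c') (transition c c') /\
  smooth_map_on (overlap c' c) (transition c' c).

(* The atlas need not be maximal. *)
Record manifold (R : realType) (d : nat) := Manifold {
  carrier :> topologicalType;
  atlas : set (chart R carrier d);
  atlas_chart : forall c, atlas c -> is_chart c;
  atlas_cover : forall p : carrier, exists2 c, atlas c & cdom c p;
  atlas_compatible : forall c c', atlas c -> atlas c' -> compatible c c';
  manifold_hausdorff : hausdorff_space carrier;
  manifold_connected : connected [set: carrier];
  manifold_paracompact : paracompact carrier }.

(* One chart of the atlas around p is chosen once and for all, and T_pM is
   identified with R^d by its coordinate basis: a tensor at p is given by its
   values on R^d in this chart.  Every condition below is an identity between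
   tensors at p (or a scalar), hence does not depend on the choice. *)
Definition chart_at (R : realType) (d : nat) (M : manifold R d) (p : M) :
    chart R M d :=
  s2val (cid2 (atlas_cover p)).

Definition smooth_fun (R : realType) (d : nat) (M : manifold R d)
    (f : M -> R) : Prop :=
  forall c, @atlas R d M c -> smooth_on (cimg c) (fun x => f (cinv c x)).

(* [gcomp g c x] is the matrix of components of the metric in the chart c at
   the point with coordinates x.  The index is constant because M is
   connected. *)
Record semi_riemannian (R : realType) (d : nat) (M : manifold R d) :=
  SemiRiemannian {
  gcomp : chart R M d -> 'rV[R]_d -> 'M[R]_d;
  gcomp_smooth : forall c, @atlas R d M c -> forall i j,
    smooth_on (cimg c) (fun x => gcomp c x i j);
  gcomp_sym : forall c, @atlas R d M c -> forall x, cimg c x ->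
    (gcomp c x)^T = gcomp c x;
  gcomp_nondeg : forall c, @atlas R d M c -> forall x, cimg c x ->
    gcomp c x \in unitmx;
  gcomp_transf : forall c c', @atlas R d M c -> @atlas R d M c' ->
    forall x, overlap c c' x ->
    let J := jacobian (transition c c') x in
    gcomp c x = J *m gcomp c' (transition c c' x) *m J^T }.

Section LocalGeometry.
Variables (R : realType) (d : nat) (g : 'rV[R]_d -> 'M[R]_d).

Definition inner (x u v : 'rV[R]_d) : R := (u *m g x *m v^T) 0 0.

Definition christoffel (k i j : 'I_d) (x : 'rV[R]_d) : R :=
  2^-1 * \sum_l invmx (g x) k l *
    (partial i (fun y => g y j l) x + partial j (fun y => g y i l) x
     - partial l (fun y => g y i j) x).

(* The Levi-Civita connection in coordinates:
   (nabla_X Y)^k = X^i d_i Y^k + Gamma^k_ij X^i Y^j. *)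
Definition nabla (X Y : 'rV[R]_d -> 'rV[R]_d) (x : 'rV[R]_d) : 'rV[R]_d :=
  'D_(X x) Y x +
  \row_k \sum_i \sum_j X x 0 i * Y x 0 j * christoffel k i j x.

Definition bracket (X Y : 'rV[R]_d -> 'rV[R]_d) (x : 'rV[R]_d) : 'rV[R]_d :=
  'D_(X x) Y x - 'D_(Y x) X x.

Definition curv_fields (X Y Z : 'rV[R]_d -> 'rV[R]_d) (x : 'rV[R]_d) :
    'rV[R]_d :=
  nabla X (nabla Y Z) x - nabla Y (nabla X Z) x - nabla (bracket X Y) Z x.

(* The curvature operator is tensorial: its value at x on tangent vectors is
   computed on the extensions with constant components. *)
Definition curv_op (x u v w : 'rV[R]_d) : 'rV[R]_d :=
  curv_fields (cst u) (cst v) (cst w) x.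

Definition riem (x u1 u2 u3 u4 : 'rV[R]_d) : R :=
  inner x (curv_op x u1 u2 u3) u4.

Definition ricci (x u v : 'rV[R]_d) : R :=
  \tr (lin1_mx (fun w => curv_op x w u v)).

Definition scal (x : 'rV[R]_d) : R :=
  \sum_i \sum_j invmx (g x) i j * ricci x (delta_mx 0 i) (delta_mx 0 j).

(* g(X1,X4) g(X2,X3) - g(X1,X3) g(X2,X4): the curvature tensor of constant
   curvature 1 for the above sign convention. *)
Definition gtensor (x u1 u2 u3 u4 : 'rV[R]_d) : R :=
  inner x u1 u4 * inner x u2 u3 - inner x u1 u3 * inner x u2 u4.

(* Kulkarni-Nomizu product of g and S, for which g /\ g = 2 gtensor. *)
Definition kn_ricci (x u1 u2 u3 u4 : 'rV[R]_d) : R :=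
  inner x u1 u4 * ricci x u2 u3 + inner x u2 u3 * ricci x u1 u4
  - inner x u1 u3 * ricci x u2 u4 - inner x u2 u4 * ricci x u1 u3.

Definition weyl (x u1 u2 u3 u4 : 'rV[R]_d) : R :=
  riem x u1 u2 u3 u4
  - (d%:R - 2)^-1 * kn_ricci x u1 u2 u3 u4
  + scal x / ((d%:R - 1) * (d%:R - 2)) * gtensor x u1 u2 u3 u4.

Definition wedge_op (x u v w : 'rV[R]_d) : 'rV[R]_d :=
  inner x v w *: u - inner x u w *: v.

(* The action on R of an endomorphism A, extended as a derivation. *)
Definition riem_act (A : 'rV[R]_d -> 'rV[R]_d) (x u1 u2 u3 u4 : 'rV[R]_d) :
    R :=
  - (riem x (A u1) u2 u3 u4 + riem x u1 (A u2) u3 u4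
     + riem x u1 u2 (A u3) u4 + riem x u1 u2 u3 (A u4)).

Definition RdotR (x u1 u2 u3 u4 u v : 'rV[R]_d) : R :=
  riem_act (curv_op x u v) x u1 u2 u3 u4.

Definition QgR (x u1 u2 u3 u4 u v : 'rV[R]_d) : R :=
  riem_act (wedge_op x u v) x u1 u2 u3 u4.

(* T_ab = nabla_a f_b - f_a f_b / (2 f), for f given in coordinates. *)
Definition warp_tensor (f : 'rV[R]_d -> R) (x : 'rV[R]_d) : 'M[R]_d :=
  \matrix_(a, b)
    (partial a (partial b f) x
     - (\sum_c christoffel c a b x * partial c f x)
     - (2 * f x)^-1 * (partial a f x * partial b f x)).

Definition metric_trace (x : 'rV[R]_d) (A : 'M[R]_d) : R :=
  \sum_a \sum_b invmx (g x) a b * A a b.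

End LocalGeometry.

Definition constant_curvature (R : realType) (d : nat) (M : manifold R d)
    (gM : semi_riemannian M) : Prop :=
  exists k : R, forall (q : M) (u1 u2 u3 u4 : 'rV[R]_d),
    riem (gcomp gM (chart_at q)) (cmap (chart_at q) q) u1 u2 u3 u4 =
    k * gtensor (gcomp gM (chart_at q)) (cmap (chart_at q) q) u1 u2 u3 u4.

Definition prod_chart (R : realType) (S T : topologicalType) (d e : nat)
    (c : chart R S d) (c' : chart R T e) : chart R (S * T)%type (d + e) :=
  Chart (cdom c `*` cdom c')
    (fun p => row_mx (cmap c p.1) (cmap c' p.2))
    (fun x => (cinv c (lsubmx x), cinv c' (rsubmx x))).

(* U is the domain of a chart of the product manifold, i.e. of one which is
   compatible with all product charts, not necessarily a product chart. *)
Definition coordinate_domain (R : realType) (d e : nat) (M : manifold R d)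
    (N : manifold R e) (U : set (M * N)) : Prop :=
  exists c : chart R (M * N)%type (d + e),
    [/\ is_chart c, cdom c = U
      & forall c1 c2, @atlas R d M c1 -> @atlas R e N c2 ->
          compatible c (prod_chart c1 c2)].

Section WarpedProduct.
Variables (R : realType) (d e : nat) (M : manifold R d) (N : manifold R e).
Variables (gM : semi_riemannian M) (gN : semi_riemannian N) (F : M -> R).

Definition warped_metric (c : chart R M d) (c' : chart R N e)
    (x : 'rV[R]_(d + e)) : 'M[R]_(d + e) :=
  block_mx (gcomp gM c (lsubmx x)) 0
           0 (F (cinv c (lsubmx x)) *: gcomp gN c' (rsubmx x)).

Definition gW (p : M * N) : 'rV[R]_(d + e) -> 'M[R]_(d + e) :=
  warped_metric (chart_at p.1) (chart_at p.2).

Definition xW (p : M * N) : 'rV[R]_(d + e) :=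
  cmap (prod_chart (chart_at p.1) (chart_at p.2)) p.

Definition U_S : set (M * N) :=
  [set p | ~ forall u v, ricci (gW p) (xW p) u v =
             scal (gW p) (xW p) / (d + e)%:R * inner (gW p) (xW p) u v].

Definition U_C : set (M * N) :=
  [set p | ~ forall u1 u2 u3 u4, weyl (gW p) (xW p) u1 u2 u3 u4 = 0].

Definition pseudosymmetric_on (U : set (M * N)) (L : M * N -> R) : Prop :=
  forall p, U p -> forall u1 u2 u3 u4 u v,
    RdotR (gW p) (xW p) u1 u2 u3 u4 u v =
    L p * QgR (gW p) (xW p) u1 u2 u3 u4 u v.

Definition gbar (p : M * N) : 'M[R]_d :=
  gcomp gM (chart_at p.1) (cmap (chart_at p.1) p.1).

Definition Twarp (p : M * N) : 'M[R]_d :=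
  warp_tensor (gcomp gM (chart_at p.1)) (fun x => F (cinv (chart_at p.1) x))
    (cmap (chart_at p.1) p.1).

Definition trT (p : M * N) : R :=
  metric_trace (gcomp gM (chart_at p.1)) (cmap (chart_at p.1) p.1) (Twarp p).

Definition Hwarp (L : M * N -> R) (p : M * N) : 'M[R]_d :=
  2^-1 *: Twarp p + (F p.1 * L p) *: gbar p.

End WarpedProduct.

(* Main.v *)
Require Import Defs.
From mathcomp Require Import all_boot all_order all_algebra.
From mathcomp Require Import all_classical all_reals all_analysis.
From mathcomp Require Import ring lra.
Set Implicit Arguments.
Unset Strict Implicit.
Unset Printing Implicit Defensive.
Import Order.TTheory GRing.Theory Num.Theory.
Import numFieldNormedType.Exports.
Local Open Scope classical_set_scope.
Local Open Scope ring_scope.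

(** Put P = - T / (2 F) and let h = F gt be the fibre part of g.  Because the
    base is 2-dimensional and the fibre has (pointwise, if it is a surface)
    constant curvature, the curvature tensor of the warped product at a point is
    K G(gbar) + c G(h) + P /\ h, where G(a) is the curvature tensor of constant
    curvature 1 of a and /\ is the Kulkarni-Nomizu product.  Let
    q = P - L gbar.  Evaluated with a mixed pair (u, v), the condition
    R.R = L Q(g, R) yields
      q(a, d) (P - K gbar)(b, c) = q(a, c) (P - K gbar)(b, d)
    and c q = q P (as endomorphisms).  Contracting the first identity over b, c
    and inserting the second gives (tr P - K - c) q = 0.  The Weyl tensor
    vanishes when tr P = K + c, so on U_C one gets q = 0, that is
    T = - 2 F L gbar.  Conversely, for P = L gbar the endomorphisms
    R(u, v) - L (u wedge v) preserve gbar and h separately, hence annihilate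
    R. *)

(** * Symmetry of second derivatives *)

(** The metric may be indefinite and is known only in coordinates, so adapted frames are avoided: a
    vector is identified by its products with all others, and traces are taken with a basis and its
    dual for the metric. The connection is handled through constant fields, whose brackets vanish,
    so the Koszul formula has three terms. Symmetry of second derivatives makes T symmetric and R
    skew in its last two arguments; with skewness in the first two, this forces the curvature tensor
    of a surface to be a multiple of G, which yields K, and the fibre curvature k when the fibre is
    a surface. In terms of phi = sqrt F, the tensor T / (2 F) is Hess(phi) / phi. The constant c is
    (k - |grad F|^2 / (4 F)) / F: the gradient term comes from the second fundamental form of the
    fibres, the division by F from using h in place of gt. That the Weyl tensor vanishes for tr P =
    K + c rests on P /\ gbar = (tr P) G(gbar), valid because the base is a surface. As L is an
    arbitrary function, both conditions are tested at one point at a time. *)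

Section Schwarz.
Context {R : realType} {V : normedModType R}.
Implicit Types (f : V -> R) (x u v : V).

Lemma differentiable_near_le f x (e : R) : 0 < e -> differentiable f x ->
  \forall w \near 0, `|f (w + x) - f x - 'd f x w| <= e * `|w|.
Proof.
move=> e0 /diff_locallyP[_ /eqaddoP/(_ e e0)].
by apply: filterS => w; rewrite /= !fctE opprD addrA.
Qed.

Lemma is_derive_line f p u (s : R) : differentiable f (p + s *: u) ->
  is_derive s 1 (fun t => f (p + t *: u)) ('D_u f (p + s *: u)).
Proof.
move=> /(@diff_derivable _ _ _ _ _ u) df.
have E : (fun h : R => h^-1 *: (((fun t => f (p + t *: u)) \o shift s) (h *: 1)
    - f (p + s *: u))) =
   (fun h : R => h^-1 *: ((f \o shift (p + s *: u)) (h *: u) - f (p + s *: u))).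
  apply/funext => h /=; congr (_ *: (f _ - _)).
  by rewrite /shift /= scalerDl [h *: 1]mulr1 addrCA addrA.
by apply: DeriveDef; rewrite /derivable /derive E.
Qed.

(** Symmetric in [u] and [v], whereas its leading term below is an iterated derivative in a chosen
    order; comparing the two orders gives the commutation. *)
Definition second_difference f x u v (h : R) :=
  f (x + h *: u + h *: v) - f (x + h *: u) - f (x + h *: v) + f x.

(* The mean value theorem along u turns the second difference into h times an
   increment of the function ['D_u f], which is differentiable at x. *)
Lemma second_difference_near f x u v (e : R) : 0 < e ->
  (\forall y \near x, differentiable f y) -> differentiable ('D_u f) x ->
  \forall h \near 0^'+,
    `|second_difference f x u v h - h ^+ 2 * 'D_v ('D_u f) x| <= e * h ^+ 2.
Proof.
move=> e0 fnear dDu.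
(* [h * N] bounds the displacements that occur; the added 1 keeps [N] positive when [u] and [v]
   vanish. *)
pose N := `|u| + `|v| + 1.
have N0 : 0 < N by rewrite ltr_wpDl// addr_ge0.
have eN0 : 0 < e / (2 * N) by rewrite divr_gt0// mulr_gt0.
have /nbhs_ballP[d1 /= d10 B1] := fnear.
have /nbhs_ballP[d2 /= d20 B2] := differentiable_near_le eN0 dDu.
near=> h.
have h0 : 0 < h by [].
have hN : h * N < Num.min d1 d2.
  rewrite -ltr_pdivlMr//; near: h; apply: nbhs_right_lt.
  by rewrite divr_gt0// lt_min d10.
move: hN; rewrite lt_min => /andP[hN1 hN2].
have wN (s t : R) : 0 <= s <= h -> 0 <= t <= h ->
    `|t *: v + s *: u| <= h * N.
  move=> /andP[s0 sh] /andP[t0 th].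
  rewrite (le_trans (ler_normD _ _))// !normrZ !ger0_norm// /N.
  have := ler_wpM2r (normr_ge0 u) sh; have := ler_wpM2r (normr_ge0 v) th.
  move: h0; lra.
have dphi (s t : R) : 0 <= s <= h -> 0 <= t <= h ->
    is_derive s 1 (fun s => f (x + t *: v + s *: u))
      ('D_u f (x + t *: v + s *: u)).
  move=> s0 t0; apply: is_derive_line; apply: B1.
  rewrite -ball_normE /ball_ /=.
  by rewrite -addrA opprD addrA subrr sub0r normrN (le_lt_trans (wN _ _ s0 t0)).
have hh : 0 <= h <= h by rewrite ltW//= lexx.
have h00 : 0 <= (0 : R) <= h by rewrite lexx ltW.
(* The increment along [v] as a function of the displacement along [u]; [phi h - phi 0] is the
   second difference. Writing [0 *: v] lets [dphi] and [err] cover both terms. *)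
pose phi s := f (x + h *: v + s *: u) - f (x + 0 *: v + s *: u).
pose dph s := 'D_u f (x + h *: v + s *: u) - 'D_u f (x + 0 *: v + s *: u).
have Dphi s : 0 <= s <= h -> is_derive s 1 phi (dph s).
  by move=> s0; apply: is_deriveB; apply: dphi.
have [s||xi + E] := @MVT R phi dph 0 h h0.
- by rewrite in_itv /= => /andP[s0 sh]; apply: Dphi; rewrite !ltW.
- apply: derivable_within_continuous => s; rewrite in_itv /= => s0.
  by have [] := Dphi _ s0.
rewrite in_itv /= => /andP[xi0 xih].
have xih' : 0 <= xi <= h by rewrite !ltW.
(* Used at [t = h] and [t = 0]: the increments along [u] cancel in the difference, and two errors
   [e / 2 * h], times the factor [h] of the mean value theorem, make [e * h ^+ 2]. *)
have err t : 0 <= t <= h ->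
    `|'D_u f (x + t *: v + xi *: u) - 'D_u f x
      - ('d ('D_u f) x (t *: v) + 'd ('D_u f) x (xi *: u))| <= e / 2 * h.
  move=> th.
  have := B2 (t *: v + xi *: u).
  rewrite -ball_normE /ball_ /= sub0r normrN (le_lt_trans (wN _ _ xih' th))//.
  move=> /(_ isT).
  rewrite linearD /= [_ + x]addrC addrA => /le_trans; apply.
  have -> : e / 2 * h = e / (2 * N) * (h * N) by field; rewrite gt_eqF.
  by rewrite ler_wpM2l ?(ltW eN0)// wN.
have := err h hh; have := err 0 h00.
rewrite scale0r linear0 add0r addr0 => E1 E2.
have -> : second_difference f x u v h = dph xi * h.
  rewrite -[h in RHS]subr0 -E /phi /second_difference !scale0r !addr0.
  by rewrite ![x + h *: v + _]addrAC; ring.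
rewrite /dph scale0r addr0 (deriveE _ dDu).
have -> : 'd ('D_u f) x v = h^-1 * 'd ('D_u f) x (h *: v).
  by rewrite linearZ; apply/esym; exact: (mulKf (lt0r_neq0 h0)).
set A := 'D_u f (x + h *: v + _) in E2 *; set B := 'D_u f (x + xi *: u) in E1 *.
set C := 'd _ _ (h *: v) in E2 *; set D := 'd _ _ _ in E1 E2 *.
set Z := 'D_u f x in E1 E2.
have -> : (A - B) * h - h ^+ 2 * (h^-1 * C) = (A - B - C) * h.
  by field; rewrite gt_eqF.
rewrite normrM (gtr0_norm h0) expr2 mulrA ler_wpM2r ?(ltW h0)//.
have -> : A - B - C = (A - Z - (C + D)) - (B - Z - D) by ring.
rewrite (le_trans (ler_normB _ _))//.
have -> : e * h = e / 2 * h + e / 2 * h by field.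
by rewrite lerD.
Unshelve. all: by end_near. Qed.

(** Both iterated derivatives, multiplied by [h ^+ 2], are within [e / 2 * h ^+ 2] of the same
    second difference for some positive [h], so they differ by at most [e]. *)
Lemma derive_commute f x u v :
  (\forall y \near x, differentiable f y) ->
  differentiable ('D_u f) x -> differentiable ('D_v f) x ->
  'D_v ('D_u f) x = 'D_u ('D_v f) x.
Proof.
move=> fnear du dv; apply/eqP; rewrite -subr_eq0 -normr_le0.
apply/ler_addgt0Pr => e e0; rewrite add0r.
have e20 : 0 < e / 2 by rewrite divr_gt0.
have N1 := second_difference_near v e20 fnear du.
have N2 := second_difference_near u e20 fnear dv.
have [h /= [[E1 +] h0]] := @filter_ex _ _ (at_right_proper_filter (0 : R)) _
  (filterI (filterI N1 N2) (nbhs_right_gt 0)).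
have -> : second_difference f x v u h = second_difference f x u v h.
  by rewrite /second_difference [x + h *: v + _]addrAC; ring.
have aux (S a b k : R) : 0 < k -> `|S - k * a| <= e / 2 * k ->
    `|S - k * b| <= e / 2 * k -> `|a - b| <= e.
  move=> k0 Ea Eb; rewrite -(@ler_pM2r _ k)// -[X in _ * X <= _](gtr0_norm k0).
  rewrite -normrM; have -> : (a - b) * k = (S - k * b) - (S - k * a) by ring.
  have -> : e * k = e / 2 * k + e / 2 * k by field.
  by rewrite (le_trans (ler_normB _ _))// lerD.
exact: aux (exprn_gt0 2 h0) E1.
Qed.

End Schwarz.

(** * Differentiability of sums, products and inverse matrices *)

Section Calculus.
Context {R : realType} {V : normedModType R}.
Implicit Types (f g : V -> R) (x u v : V).

(** Closed formulas for derivatives hold only where the functions are differentiable, hence only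
    near [x]; this lemma carries differentiability across them. *)
Lemma near_eq_differentiable f g x : (\forall y \near x, f y = g y) ->
  differentiable f x -> differentiable g x.
Proof.
move=> fg /diff_locallyP[cd E].
have E' : g \o shift x = cst (g x) + 'd f x +o_0 id.
  apply/eqaddoP => e e0; move/eqaddoP: E => /(_ e e0) E.
  have fgx : f x = g x := nbhs_singleton fg.
  have fg0 : \forall w \near 0, f (w + x) = g (w + x).
    move: fg => /nbhs_ballP[d /= d0 B]; apply/nbhs_ballP; exists d => // w.
    rewrite -ball_normE /ball_ /= sub0r normrN => wd; apply: B.
    by rewrite -ball_normE /ball_ /= opprD addrCA subrr addr0 normrN.
  apply: filterS2 fg0 E => w fgw.
  by rewrite /= !fctE -fgx -fgw.
by apply/diff_locallyP; rewrite (diff_unique cd E').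
Qed.

Lemma derive_differentiable_linear f x (a : R) u v : differentiable f x ->
  'D_(a *: u + v) f x = a * 'D_u f x + 'D_v f x.
Proof. by move=> df; rewrite !deriveE// linearP. Qed.

Lemma differentiable_bigsum (I : Type) (r : seq I) (P : pred I)
    (F : I -> V -> R) x :
  (forall i, P i -> differentiable (F i) x) ->
  differentiable (fun y => \sum_(i <- r | P i) F i y) x.
Proof.
move=> dF; elim: r => [|i r IH].
  by under eq_fun do rewrite big_nil; exact: differentiable_cst.
under eq_fun do rewrite big_cons.
by case Pi: (P i) => //; apply: differentiableD => //; exact: dF.
Qed.

Lemma differentiable_bigprod (I : Type) (r : seq I) (P : pred I)
    (F : I -> V -> R) x :
  (forall i, P i -> differentiable (F i) x) ->
  differentiable (fun y => \prod_(i <- r | P i) F i y) x.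
Proof.
move=> dF; elim: r => [|i r IH].
  by under eq_fun do rewrite big_nil; exact: differentiable_cst.
under eq_fun do rewrite big_cons.
by case Pi: (P i) => //; apply: differentiableM => //; exact: dF.
Qed.

Lemma derive_bigsum (I : Type) (r : seq I) (P : pred I)
    (F : I -> V -> R) x v :
  (forall i, P i -> differentiable (F i) x) ->
  'D_v (fun y => \sum_(i <- r | P i) F i y) x =
  \sum_(i <- r | P i) 'D_v (F i) x.
Proof.
move=> dF; elim: r => [|i r IH].
  rewrite big_nil; under eq_fun do rewrite big_nil; exact: derive_cst.
rewrite big_cons; under eq_fun do rewrite big_cons.
case Pi: (P i) => //; rewrite -IH [LHS]deriveD//; apply: diff_derivable.
  exact: dF.
exact: differentiable_bigsum.
Qed.

Lemma derive_mul f g x v : differentiable f x -> differentiable g x ->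
  'D_v (fun y => f y * g y) x = f x * 'D_v g x + g x * 'D_v f x.
Proof. by move=> df dg; rewrite [LHS]deriveM//; exact: diff_derivable. Qed.

Lemma derive_add f g x v : differentiable f x -> differentiable g x ->
  'D_v (fun y => f y + g y) x = 'D_v f x + 'D_v g x.
Proof. by move=> df dg; rewrite [LHS]deriveD//; exact: diff_derivable. Qed.

Lemma derive_scale f x v (a : R) : differentiable f x ->
  'D_v (fun y => a * f y) x = a * 'D_v f x.
Proof. by move=> df; rewrite [LHS]deriveMl//; exact: diff_derivable. Qed.

Lemma differentiable_det n (A : V -> 'M[R]_n) x :
  (forall i j, differentiable (fun y => A y i j) x) ->
  differentiable (fun y => \det (A y)) x.
Proof.
move=> dA; apply: differentiable_bigsum => s _.
apply: differentiableM; first exact: differentiable_cst.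
by apply: differentiable_bigprod => i _; exact: dA.
Qed.

(** Cramer's rule. Invertibility is asked near [x] because [invmx] returns a singular matrix
    unchanged, so the cofactor formula fails there. *)
Lemma differentiable_invmx n (A : V -> 'M[R]_n) x i j :
  (\forall y \near x, A y \in unitmx) ->
  (forall i j, differentiable (fun y => A y i j) x) ->
  differentiable (fun y => invmx (A y) i j) x.
Proof.
move=> uA dA.
apply: (@near_eq_differentiable
    (fun y => (\det (A y))^-1 * cofactor (A y) j i)).
  by apply: filterS uA => y uy; rewrite /invmx uy !mxE.
apply: differentiableM.
  apply: differentiableV; first exact: differentiable_det.
  by have := nbhs_singleton uA; rewrite unitmxE unitfE.
apply: differentiableM; first exact: differentiable_cst.
apply: differentiable_det => k l.
by under eq_fun do rewrite !mxE; exact: dA.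
Qed.

End Calculus.

(** * Twice differentiable functions *)

Section C2.
Context {R : realType} {V : normedModType R}.
Implicit Types (f g : V -> R) (x u v : V) (D : set V).

Definition C2 D f := forall x, D x ->
  differentiable f x /\ forall v, differentiable ('D_v f) x.

Lemma C2_bigsum (I : Type) (r : seq I) (P : pred I) D (F : I -> V -> R) :
  open D -> (forall i, P i -> C2 D (F i)) ->
  C2 D (fun y => \sum_(i <- r | P i) F i y).
Proof.
move=> oD FC x Dx; split=> [|v].
  by apply: differentiable_bigsum => i Pi; case: (FC i Pi x Dx).
apply: (@near_eq_differentiable _ _
    (fun y => \sum_(i <- r | P i) 'D_v (F i) y)).
  apply: filterS (open_nbhs_nbhs (conj oD Dx)) => y Dy.
  by rewrite derive_bigsum// => i Pi; case: (FC i Pi y Dy).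
by apply: differentiable_bigsum => i Pi; case: (FC i Pi x Dx) => _; apply.
Qed.

Lemma C2_scale D (a : R) f : open D -> C2 D f -> C2 D (fun y => a * f y).
Proof.
move=> oD fC x Dx; split=> [|v].
  by apply: differentiableM; [exact: differentiable_cst|case: (fC x Dx)].
apply: (@near_eq_differentiable _ _ (fun y => a * 'D_v f y)).
  apply: filterS (open_nbhs_nbhs (conj oD Dx)) => y Dy.
  by rewrite deriveMl//; apply: diff_derivable; case: (fC y Dy).
apply: differentiableM; first exact: differentiable_cst.
by case: (fC x Dx) => _; apply.
Qed.

Lemma C2_commute D f x u v : open D -> C2 D f -> D x ->
  'D_u ('D_v f) x = 'D_v ('D_u f) x.
Proof.
move=> oD fC Dx; have [_ df] := fC x Dx.
apply: derive_commute => //.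
apply: filterS (open_nbhs_nbhs (conj oD Dx)) => y Dy; by case: (fC y Dy).
Qed.

End C2.

Lemma derive_partial (R : realType) d (f : 'rV[R]_d -> R) x v :
  differentiable f x -> 'D_v f x = \sum_i v 0 i * partial i f x.
Proof.
move=> df; rewrite deriveE// {1}(row_sum_delta v) linear_sum /=.
by apply: eq_bigr => i _; rewrite linearZ /partial deriveE.
Qed.

(** Smoothness speaks of coordinate directions only; near [x] any ['D_v f] is a constant combination
    of partial derivatives. *)
Lemma smooth_on_C2 (R : realType) d (D : set 'rV[R]_d) f :
  open D -> smooth_on D f -> C2 D f.
Proof.
move=> oD sf x Dx; split=> [|v]; first exact: (sf [::] x Dx).
apply: (@near_eq_differentiable _ _ (fun y => \sum_i v 0 i * partial i f y)).
  apply: filterS (open_nbhs_nbhs (conj oD Dx)) => y Dy.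
  by rewrite derive_partial//; exact: (sf [::] y Dy).
apply: differentiable_bigsum => i _; apply: differentiableM.
  exact: differentiable_cst.
exact: (sf [:: i] x Dx).
Qed.

Section RowFields.
Context {R : realType} {V : normedModType R} {d : nat}.
Implicit Types (X : V -> 'rV[R]_d) (x u v : V).

Definition differentiable_row X x :=
  forall k, differentiable (fun y => X y 0 k) x.

Lemma derive_row X x v k : differentiable_row X x ->
  ('D_v X x) 0 k = 'D_v (fun y => X y 0 k) x.
Proof.
move=> dX; rewrite derive_mx ?mxE//; apply/derivable_mxP => i j.
by rewrite ord1; exact: diff_derivable.
Qed.

End RowFields.

(** * The bilinear form of a matrix field *)

Section Inner.
Context {R : realType} {d : nat}.
Variable (g : 'rV[R]_d -> 'M[R]_d).
Implicit Types (x u v w : 'rV[R]_d).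

Lemma innerE x u v : inner g x u v = \sum_i \sum_j u 0 i * v 0 j * g x i j.
Proof.
rewrite /inner mxE exchange_big /=; apply: eq_bigr => j _.
rewrite !mxE mulr_suml; apply: eq_bigr => i _; ring.
Qed.

Lemma inner_linearl x v a u w :
  inner g x (a *: u + w) v = a * inner g x u v + inner g x w v.
Proof. by rewrite /inner mulmxDl mulmxDl -!scalemxAl [LHS]mxE mxE. Qed.

Lemma inner_linearr x u a v w :
  inner g x u (a *: v + w) = a * inner g x u v + inner g x u w.
Proof.
by rewrite /inner linearP mulmxDr /= -scalemxAr [LHS]mxE mxE.
Qed.

Lemma innerDl x u v w : inner g x (u + v) w = inner g x u w + inner g x v w.
Proof. by rewrite -{1}[u]scale1r inner_linearl mul1r. Qed.

Lemma innerDr x u v w : inner g x w (u + v) = inner g x w u + inner g x w v.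
Proof. by rewrite -{1}[u]scale1r inner_linearr mul1r. Qed.

Lemma inner0l x v : inner g x 0 v = 0.
Proof. by rewrite /inner !mul0mx mxE. Qed.

Lemma inner0r x v : inner g x v 0 = 0.
Proof. by rewrite /inner trmx0 mulmx0 mxE. Qed.

Lemma innerZl x a u v : inner g x (a *: u) v = a * inner g x u v.
Proof. by rewrite -[a *: u]addr0 inner_linearl inner0l addr0. Qed.

Lemma innerZr x a u v : inner g x u (a *: v) = a * inner g x u v.
Proof. by rewrite -[a *: v]addr0 inner_linearr inner0r addr0. Qed.

Lemma innerNl x u v : inner g x (- u) v = - inner g x u v.
Proof. by rewrite -scaleN1r innerZl mulN1r. Qed.

Lemma innerNr x u v : inner g x u (- v) = - inner g x u v.
Proof. by rewrite -scaleN1r innerZr mulN1r. Qed.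

Definition inner_lin := (innerDl, innerDr, innerZl, innerZr, innerNl, innerNr).

(** Nondegeneracy. Connection and curvature are computed below by testing against an arbitrary
    vector. *)
Lemma inner_inj x u v : g x \in unitmx ->
  (forall w, inner g x u w = inner g x v w) -> u = v.
Proof.
move=> ug E; apply: (can_inj (mulmxK ug)).
apply/rowP => k; have := E 'e_k.
by rewrite /inner trmx_delta -!colE !mxE.
Qed.

End Inner.

(** * Christoffel map and curvature *)

(* The bilinear Christoffel map: [gam g v w] is the covariant derivative of the
   constant field w along the constant field v. *)
Definition gam (R : realType) d (g : 'rV[R]_d -> 'M[R]_d) (v w x : 'rV[R]_d) :
    'rV[R]_d :=
  \row_k \sum_i \sum_j v 0 i * w 0 j * christoffel g k i j x.

Section Gam.
Context {R : realType} {d : nat}.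
Variable (g : 'rV[R]_d -> 'M[R]_d).
Implicit Types (x u v w : 'rV[R]_d).

Lemma nabla_cst v w : nabla g (cst v) (cst w) = gam g v w.
Proof. by apply/funext => x; rewrite /nabla derive_cst add0r. Qed.

Lemma nabla_cstl u Y x : nabla g (cst u) Y x = 'D_u Y x + gam g u (Y x) x.
Proof. by []. Qed.

Lemma gam_linearl x w a u v :
  gam g (a *: u + v) w x = a *: gam g u w x + gam g v w x.
Proof.
 apply/rowP => k; rewrite !mxE mulr_sumr -big_split /=.
apply: eq_bigr => i _; rewrite mulr_sumr -big_split /=; apply: eq_bigr => j _.
by rewrite !mxE; ring.
Qed.

Lemma gam_linearr x w a u v :
  gam g w (a *: u + v) x = a *: gam g w u x + gam g w v x.
Proof.
 apply/rowP => k; rewrite !mxE mulr_sumr -big_split /=.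
apply: eq_bigr => i _; rewrite mulr_sumr -big_split /=; apply: eq_bigr => j _.
by rewrite !mxE; ring.
Qed.

Lemma gam0l x w : gam g 0 w x = 0.
Proof.
have := gam_linearl x w (-1) 0 0.
by rewrite scaler0 addr0 scaleN1r addNr.
Qed.

Lemma gam0r x w : gam g w 0 x = 0.
Proof.
have := gam_linearr x w (-1) 0 0.
by rewrite scaler0 addr0 scaleN1r addNr.
Qed.

(** Constant fields commute, so the bracket term drops out. *)
Lemma curv_opE x u v w : curv_op g x u v w =
  'D_u (gam g v w) x + gam g u (gam g v w x) x
  - ('D_v (gam g u w) x + gam g v (gam g u w x) x).
Proof.
rewrite /curv_op /curv_fields !nabla_cst !nabla_cstl.
have -> : bracket (cst u) (cst v) = cst 0.
  by apply/funext => y; rewrite /bracket !derive_cst subrr.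
by rewrite nabla_cst gam0l subr0.
Qed.

Lemma curv_op_skew12 x u v w : curv_op g x u v w = - curv_op g x v u w.
Proof. by rewrite !curv_opE opprB. Qed.

End Gam.

(** A metric on an open set of coordinates. Both factors and the warped product are instances, so
    the same lemmas serve all three. *)
Record local_metric (R : realType) d (g : 'rV[R]_d -> 'M[R]_d)
    (D : set 'rV[R]_d) : Prop := LocalMetric {
  lm_open : open D;
  lm_C2 : forall i j, C2 D (fun y => g y i j);
  lm_sym : forall x, D x -> (g x)^T = g x;
  lm_unit : forall x, D x -> g x \in unitmx }.

Section LocalMetric.
Context {R : realType} {d : nat}.
Variables (g : 'rV[R]_d -> 'M[R]_d) (D : set 'rV[R]_d).
Hypothesis gD : local_metric g D.
Implicit Types (x u v w z : 'rV[R]_d).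

Lemma lm_near x : D x -> \forall y \near x, D y.
Proof. by move=> Dx; apply: open_nbhs_nbhs; split=> //; case: gD. Qed.

Lemma inner_sym x u v : D x -> inner g x u v = inner g x v u.
Proof.
move=> Dx; rewrite /inner -[in RHS](lm_sym gD Dx) -[v in RHS]trmxK.
by rewrite -!trmx_mul [RHS]mxE mulmxA.
Qed.

Lemma C2_inner v w : C2 D (fun y => inner g y v w).
Proof.
have oD := lm_open gD.
under eq_fun do rewrite innerE.
apply: C2_bigsum => // i _; apply: C2_bigsum => // j _.
exact: C2_scale (lm_C2 gD _ _).
Qed.

Lemma differentiable_inner x v w : D x ->
  differentiable (fun y => inner g y v w) x.
Proof. by move=> Dx; case: (C2_inner v w Dx). Qed.

Lemma derive_inner_sym x u v w : D x ->
  'D_u (fun y => inner g y v w) x = 'D_u (fun y => inner g y w v) x.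
Proof.
move=> Dx; apply: near_eq_derive; apply: filterS (lm_near Dx) => y Dy.
exact: inner_sym.
Qed.

Lemma derive_innerE x u v w : D x -> 'D_u (fun y => inner g y v w) x =
  \sum_i \sum_j v 0 i * w 0 j * \sum_k u 0 k * partial k (fun y => g y i j) x.
Proof.
move=> Dx; have dg i j : differentiable (fun y => g y i j) x.
  by case: (lm_C2 gD i j Dx).
under eq_fun do rewrite innerE.
rewrite derive_bigsum => [|i _]; last first.
  apply: differentiable_bigsum => j _.
  by apply: differentiableM; [exact: differentiable_cst|exact: dg].
apply: eq_bigr => i _; rewrite derive_bigsum => [|j _]; last first.
  by apply: differentiableM; [exact: differentiable_cst|exact: dg].
apply: eq_bigr => j _; rewrite deriveMl; last exact: diff_derivable.
by rewrite derive_partial.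
Qed.

(** The Koszul formula for constant fields. *)
Lemma inner_gam x u v w : D x ->
  inner g x (gam g u v x) w =
  2^-1 * ('D_u (fun y => inner g y v w) x + 'D_v (fun y => inner g y u w) x
          - 'D_w (fun y => inner g y u v) x).
Proof.
move=> Dx; rewrite !derive_innerE//.
pose p k i j := partial k (fun y => g y i j) x.
transitivity (\sum_i \sum_j \sum_l u 0 i * v 0 j * w 0 l *
    (2^-1 * (p i j l + p j i l - p l i j))).
  rewrite /inner; set c := gam g u v x.
  (* Christoffel symbols of the first kind with the index raised by the inverse metric; multiplying
     by [g x] lowers it again. *)
  have -> : c = (\row_m \sum_i \sum_j u 0 i * v 0 j *
      (2^-1 * (p i j m + p j i m - p m i j))) *m (invmx (g x))^T.
    apply/rowP => k; rewrite !mxE.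
    under [RHS]eq_bigr do rewrite !mxE mulr_suml.
    rewrite [RHS]exchange_big; apply: eq_bigr => i _ /=.
    under [RHS]eq_bigr do rewrite mulr_suml.
    rewrite [RHS]exchange_big; apply: eq_bigr => j _ /=.
    rewrite /christoffel !mulr_sumr; apply: eq_bigr => l _.
    rewrite /p; ring.
  rewrite trmx_inv (lm_sym gD Dx).
  rewrite -[X in X *m _]mulmxA mulVmx ?(lm_unit gD)// mulmx1 mxE.
  under [LHS]eq_bigr do rewrite !mxE mulr_suml.
  rewrite [LHS]exchange_big; apply: eq_bigr => i _ /=.
  under [LHS]eq_bigr do rewrite mulr_suml.
  rewrite [LHS]exchange_big; apply: eq_bigr => j _ /=.
  apply: eq_bigr => l _; ring.
have E1 : \sum_i \sum_j v 0 i * w 0 j * (\sum_k u 0 k * p k i j) =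
    \sum_i \sum_j \sum_l u 0 i * v 0 j * w 0 l * p i j l.
  rewrite [RHS]exchange_big; apply: eq_bigr => i _ /=.
  rewrite [RHS]exchange_big; apply: eq_bigr => j _ /=.
  rewrite mulr_sumr; apply: eq_bigr => k _; ring.
have E2 : \sum_i \sum_j u 0 i * w 0 j * (\sum_k v 0 k * p k i j) =
    \sum_i \sum_j \sum_l u 0 i * v 0 j * w 0 l * p j i l.
  apply: eq_bigr => i _ /=.
  rewrite [RHS]exchange_big; apply: eq_bigr => j _ /=.
  rewrite mulr_sumr; apply: eq_bigr => k _; ring.
have E3 : \sum_i \sum_j u 0 i * v 0 j * (\sum_k w 0 k * p k i j) =
    \sum_i \sum_j \sum_l u 0 i * v 0 j * w 0 l * p l i j.
  apply: eq_bigr => i _ /=; apply: eq_bigr => j _ /=.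
  rewrite mulr_sumr; apply: eq_bigr => k _; ring.
rewrite /p in E1 E2 E3; rewrite E1 E2 E3 /p -sumrN -!big_split mulr_sumr.
apply: eq_bigr => i _; rewrite /= -sumrN -!big_split mulr_sumr.
apply: eq_bigr => j _; rewrite /= -sumrN -!big_split mulr_sumr.
apply: eq_bigr => l _ /=; ring.
Qed.

Lemma gam_sym x u v : D x -> gam g u v x = gam g v u x.
Proof.
move=> Dx; apply: (inner_inj (lm_unit gD Dx)) => w.
by rewrite !inner_gam// (derive_inner_sym _ u v Dx) [X in X - _]addrC.
Qed.

(** In the sum of the two Koszul formulas the derivatives along [v] and [w] cancel. *)
Lemma metric_compat x u v w : D x ->
  'D_u (fun y => inner g y v w) x =
  inner g x (gam g u v x) w + inner g x v (gam g u w x).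
Proof.
move=> Dx; rewrite (inner_sym _ (gam _ _ _ _) Dx) !inner_gam//.
rewrite (derive_inner_sym u w v Dx).
set a := 'D_u _ x; set b := 'D_v _ x; set c := 'D_w _ x.
by move: (a : R) (b : R) (c : R) => a' b' c'; field.
Qed.

Lemma differentiable_gam x v w : D x -> differentiable_row (gam g v w) x.
Proof.
move=> Dx k; under eq_fun do rewrite mxE.
apply: differentiable_bigsum => i _; apply: differentiable_bigsum => j _.
apply: differentiableM; first exact: differentiable_cst.
apply: differentiableM; first exact: differentiable_cst.
have dp a b c : differentiable (partial a (fun y => g y b c)) x.
  by have [_] := lm_C2 gD b c Dx; apply.
apply: differentiable_bigsum => l _; apply: differentiableM.
  apply: differentiable_invmx => [|a b]; last by case: (lm_C2 gD a b Dx).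
  by apply: filterS (lm_near Dx) => y; exact: lm_unit.
by apply: differentiableB => //; apply: differentiableD.
Qed.

(** Product rule with the field frozen at [x] in the first term, so that [metric_compat], stated for
    constant fields, applies to it. *)
Lemma derive_inner_field (X : 'rV[R]_d -> 'rV[R]_d) x u w : D x ->
  differentiable_row X x ->
  'D_u (fun y => inner g y (X y) w) x =
  'D_u (fun y => inner g y (X x) w) x + inner g x ('D_u X x) w.
Proof.
move=> Dx dX; have dg i j : differentiable (fun y => g y i j) x.
  by case: (lm_C2 gD i j Dx).
have H (Y : 'rV[R]_d -> 'rV[R]_d) : differentiable_row Y x ->
    'D_u (fun y => inner g y (Y y) w) x = \sum_i \sum_j
     (w 0 j * g x i j * 'D_u (fun y => Y y 0 i) x +
      Y x 0 i * w 0 j * 'D_u (fun y => g y i j) x).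
  move=> dY; under eq_fun do rewrite innerE.
  have dT i j : differentiable (fun y => Y y 0 i * w 0 j * g y i j) x.
    apply: differentiableM => //; apply: differentiableM => //.
  rewrite derive_bigsum => [|i _]; last exact: differentiable_bigsum.
  apply: eq_bigr => i _; rewrite derive_bigsum//.
  apply: eq_bigr => j _.
  rewrite derive_mul//; last exact: differentiableM.
  have -> : (fun y => Y y 0 i * w 0 j) = (fun y => w 0 j * Y y 0 i).
    by apply/funext => y; rewrite mulrC.
  rewrite derive_scale// addrC mulrA; congr (_ * _ + _).
  exact: mulrC.
rewrite (H _ dX) (H (fun=> X x)) => [|k]; last exact: differentiable_cst.
rewrite innerE -big_split /=; apply: eq_bigr => i _.
rewrite -big_split /=; apply: eq_bigr => j _.
rewrite derive_cst mulr0 add0r addrC derive_row//; congr (_ + _).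
by rewrite mulrAC [X in X * _]mulrC.
Qed.

End LocalMetric.

Lemma row_linearE (R : pzRingType) n (a : R) (u v : 'rV[R]_n) k :
  (a *: u + v) 0 k = a * u 0 k + v 0 k.
Proof. by rewrite !mxE. Qed.

Lemma subr_linear_comb (R : pzRingType) (V : lmodType R) (a : R)
    (p p' q q' r r' s s' : V) :
  a *: p + p' + (a *: q + q') - (a *: r + r' + (a *: s + s')) =
  a *: (p + q - (r + s)) + (p' + q' - (r' + s')).
Proof.
rewrite (addrACA (a *: p)) (addrACA (a *: r)) -!scalerDr opprD addrACA.
by rewrite -scalerBr.
Qed.

Section RowFieldsLinear.
Context {R : realType} {V : normedModType R} {d : nat}.
Implicit Types (X Y : V -> 'rV[R]_d) (x u v : V).

Lemma derive_row_linear X Y x v (a : R) :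
  differentiable_row X x -> differentiable_row Y x ->
  'D_v (fun y => a *: X y + Y y) x = a *: 'D_v X x + 'D_v Y x.
Proof.
move=> dX dY.
have E k : (fun y => (a *: X y + Y y) 0 k) = (fun y => a * X y 0 k + Y y 0 k).
  by apply/funext => y; rewrite row_linearE.
have dS k : differentiable (fun y => a * X y 0 k) x.
  by apply: differentiableM => //; exact: differentiable_cst.
apply/rowP => k; rewrite derive_row => [|l]; rewrite E.
  by rewrite derive_add// derive_scale// row_linearE !derive_row.
by apply: differentiableD.
Qed.

Lemma derive_dir_row_linear X x u v (a : R) : differentiable_row X x ->
  'D_(a *: u + v) X x = a *: 'D_u X x + 'D_v X x.
Proof.
move=> dX; apply/rowP => k.
rewrite row_linearE !derive_row//.
exact: derive_differentiable_linear.
Qed.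

End RowFieldsLinear.

(** * Symmetries of the curvature tensor *)

Section CurvatureSymmetries.
Context {R : realType} {d : nat}.
Variables (g : 'rV[R]_d -> 'M[R]_d) (D : set 'rV[R]_d).
Hypothesis gD : local_metric g D.
Implicit Types (x u v w z : 'rV[R]_d).

Lemma curv_op_linear1 x u u' v w (a : R) : D x ->
  curv_op g x (a *: u + u') v w = a *: curv_op g x u v w + curv_op g x u' v w.
Proof.
move=> Dx; rewrite !curv_opE.
have dG := differentiable_gam gD _ _ Dx.
rewrite derive_dir_row_linear//.
have -> : gam g (a *: u + u') w = fun y => a *: gam g u w y + gam g u' w y.
  by apply/funext => y; rewrite gam_linearl.
rewrite derive_row_linear// gam_linearl gam_linearr.
exact: subr_linear_comb.
Qed.

Lemma curv_op_linear3 x u v w w' (a : R) : D x ->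
  curv_op g x u v (a *: w + w') = a *: curv_op g x u v w + curv_op g x u v w'.
Proof.
move=> Dx; rewrite !curv_opE.
have dG := differentiable_gam gD _ _ Dx.
have E p : gam g p (a *: w + w') = fun y => a *: gam g p w y + gam g p w' y.
  by apply/funext => y; rewrite gam_linearr.
rewrite !E !derive_row_linear// !gam_linearr.
exact: subr_linear_comb.
Qed.

Lemma differentiable_inner_field (X : 'rV[R]_d -> 'rV[R]_d) x w : D x ->
  differentiable_row X x -> differentiable (fun y => inner g y (X y) w) x.
Proof.
move=> Dx dX; under eq_fun do rewrite innerE.
apply: differentiable_bigsum => i _; apply: differentiable_bigsum => j _.
apply: differentiableM; last by case: (lm_C2 gD i j Dx).
apply: differentiableM; [exact: dX|exact: differentiable_cst].
Qed.

(** Metric compatibility moves the outer covariant derivative onto [z], leaving only derivatives of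
    scalar functions. *)
Lemma riem_gam x u v w z : D x -> riem g x u v w z =
  'D_u (fun y => inner g y (gam g v w y) z) x
  - inner g x (gam g v w x) (gam g u z x)
  - ('D_v (fun y => inner g y (gam g u w y) z) x
     - inner g x (gam g u w x) (gam g v z x)).
Proof.
move=> Dx; have dG := differentiable_gam gD _ _ Dx.
rewrite /riem curv_opE innerDl innerNl !innerDl.
rewrite (derive_inner_field gD u z Dx (dG v w)).
rewrite (derive_inner_field gD v z Dx (dG u w)) !(metric_compat gD)//.
set a := inner g x ('D_u _ x) z; set b := inner g x ('D_v _ x) z.
by move: (a : R) (b : R) => {}a {}b; ring.
Qed.

Lemma derive_gam_sym x u v w z : D x ->
  'D_u (fun y => inner g y (gam g v w y) z) x
  + 'D_u (fun y => inner g y (gam g v z y) w) x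
  = 'D_u ('D_v (fun y => inner g y w z)) x.
Proof.
move=> Dx; have dG := differentiable_gam gD _ _ Dx.
rewrite -deriveD; [|apply: diff_derivable; exact: differentiable_inner_field..].
apply: near_eq_derive; apply: filterS (lm_near gD Dx) => y Dy.
rewrite (metric_compat gD)//; congr (_ + _); exact: (inner_sym gD).
Qed.

(** In the symmetrisation over [w] and [z] the products of connection terms cancel; what remains is
    the commutator of ['D_u] and ['D_v] on the function g(w, z). *)
Lemma riem_skew34 x u v w z : D x -> riem g x u v w z = - riem g x u v z w.
Proof.
move=> Dx; rewrite !riem_gam//.
have := C2_commute u v (lm_open gD) (C2_inner gD w z) Dx.
rewrite -!derive_gam_sym//.
rewrite (inner_sym gD (gam g v z x))// (inner_sym gD (gam g u z x))//.
set a := 'D_u _ x; set b := 'D_u _ x; set c := 'D_v _ x; set e := 'D_v _ x.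
by move: (a : R) (b : R) (c : R) (e : R) => {}a {}b {}c {}e; lra.
Qed.

Lemma riem_skew12 x u v w z : riem g x u v w z = - riem g x v u w z.
Proof. by rewrite /riem curv_op_skew12 innerNl. Qed.

End CurvatureSymmetries.

(** * Curvature tensors of surfaces *)

Section DimensionTwo.
Context {R : realType}.
Implicit Types (u v w z : 'rV[R]_2).

Lemma row2_delta u : u = u 0 0 *: 'e_0 + (u 0 1 *: 'e_1 + 0).
Proof.
have -> : 1 = lift ord0 ord0 :> 'I_2 by exact: val_inj.
by rewrite {1}(row_sum_delta u) big_ord_recl big_ord1 addr0.
Qed.

Definition det2 u v := u 0 0 * v 0 1 - u 0 1 * v 0 0.

Lemma skew_form2 (f : 'rV[R]_2 -> 'rV[R]_2 -> R) :
  (forall a u u' v, f (a *: u + u') v = a * f u v + f u' v) ->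
  (forall u v, f u v = - f v u) ->
  forall u v, f u v = det2 u v * f 'e_0 'e_1.
Proof.
move=> fl fs u v.
have f0 w : f 0 w = 0.
  by have := fl (-1) 0 0 w; rewrite scaler0 addr0 mulN1r addNr.
have ff w : f w w = 0 by have := fs w w; lra.
rewrite [in f u v](row2_delta u) !fl f0 addr0 (fs _ v) (fs _ v).
rewrite [in f v _](row2_delta v) [in f v 'e_1](row2_delta v) !fl !f0 !ff.
rewrite (fs 'e_1 'e_0) /det2; ring.
Qed.

Lemma skew_form4 (f : 'rV[R]_2 -> 'rV[R]_2 -> 'rV[R]_2 -> 'rV[R]_2 -> R) :
  (forall a u u' v w z, f (a *: u + u') v w z = a * f u v w z + f u' v w z) ->
  (forall a u v w w' z, f u v (a *: w + w') z = a * f u v w z + f u v w' z) ->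
  (forall u v w z, f u v w z = - f v u w z) ->
  (forall u v w z, f u v w z = - f u v z w) ->
  forall u v w z, f u v w z = det2 u v * det2 w z * f 'e_0 'e_1 'e_0 'e_1.
Proof.
move=> l1 l3 s12 s34 u v w z.
rewrite (@skew_form2 (fun u v => f u v w z))// (@skew_form2 (f 'e_0 'e_1))//.
ring.
Qed.

Lemma det_matrix2 (A : 'M[R]_2) : \det A = A 0 0 * A 1 1 - A 0 1 * A 1 0.
Proof.
rewrite (expand_det_row _ ord0) !big_ord_recl big_ord0 /cofactor !det_mx11 !mxE.
have -> : 1 = lift ord0 ord0 :> 'I_2 by exact: val_inj.
have -> : lift (lift ord0 ord0) ord0 = ord0 :> 'I_2 by exact: val_inj.
rewrite /= expr0 expr1; ring.
Qed.

(** The value is minus the determinant of [g x]. *)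
Lemma gtensor2_neq0 (g : 'rV[R]_2 -> 'M[R]_2) x :
  (g x)^T = g x -> g x \in unitmx -> gtensor g x 'e_0 'e_1 'e_0 'e_1 != 0.
Proof.
move=> gs; rewrite unitmxE unitfE; apply: contraNneq => E.
have gE i j : inner g x 'e_i 'e_j = g x i j.
  by rewrite /inner trmx_delta -rowE -colE !mxE.
have gs10 : g x 1 0 = g x 0 1 by rewrite -{1}gs mxE.
move: E; rewrite /gtensor !gE det_matrix2 gs10 => E.
by apply/eqP; rewrite -[RHS]oppr0 -E; ring.
Qed.

Lemma gtensor_skew_form4 (g : 'rV[R]_2 -> 'M[R]_2) x u v w z :
  gtensor g x u v w z =
  det2 u v * det2 w z * gtensor g x 'e_0 'e_1 'e_0 'e_1.
Proof.
apply: (@skew_form4 (gtensor g x)) => *; rewrite /gtensor ?inner_lin; ring.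
Qed.

(** Both tensors are skew in each pair, hence fixed by one value; [K], the Gaussian curvature at
    [x], is the ratio of these values. *)
Lemma riem_dim2 (g : 'rV[R]_2 -> 'M[R]_2) (D : set 'rV[R]_2) x :
  local_metric g D -> D x ->
  exists K, forall u v w z, riem g x u v w z = K * gtensor g x u v w z.
Proof.
move=> gD Dx.
exists (riem g x 'e_0 'e_1 'e_0 'e_1 / gtensor g x 'e_0 'e_1 'e_0 'e_1).
move=> u v w z; rewrite (gtensor_skew_form4 _ _ u) (@skew_form4 (riem g x)).
- field; exact: (gtensor2_neq0 (lm_sym gD Dx) (lm_unit gD Dx)).
- by move=> *; rewrite /riem (curv_op_linear1 gD)// inner_linearl.
- by move=> *; rewrite /riem (curv_op_linear3 gD)// inner_linearl.
- exact: riem_skew12.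
- by move=> *; exact: (riem_skew34 gD).
Qed.

End DimensionTwo.

(** * Curvature of warped products *)

Section SubmatrixDerivatives.
Context {R : realType} {d e : nat} {W : normedModType R}.
Implicit Types (x v : 'rV[R]_(d + e)).

Lemma derive_lsubmx (f : 'rV[R]_d -> W) x v :
  'D_v (fun y => f (lsubmx y)) x = 'D_(lsubmx v) f (lsubmx x).
Proof.
have E : (fun h : R => h^-1 *: (((fun y => f (lsubmx y)) \o shift x) (h *: v)
    - f (lsubmx x))) = (fun h : R => h^-1 *: ((f \o shift (lsubmx x))
    (h *: lsubmx v) - f (lsubmx x))).
  apply/funext => h /=; congr (_ *: (f _ - _)).
  by apply/rowP => k; rewrite !mxE.
by rewrite /derive E.
Qed.

Lemma derive_rsubmx (f : 'rV[R]_e -> W) x v :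
  'D_v (fun y => f (rsubmx y)) x = 'D_(rsubmx v) f (rsubmx x).
Proof.
have E : (fun h : R => h^-1 *: (((fun y => f (rsubmx y)) \o shift x) (h *: v)
    - f (rsubmx x))) = (fun h : R => h^-1 *: ((f \o shift (rsubmx x))
    (h *: rsubmx v) - f (rsubmx x))).
  apply/funext => h /=; congr (_ *: (f _ - _)).
  by apply/rowP => k; rewrite !mxE.
by rewrite /derive E.
Qed.

Lemma differentiable_comp_lsubmx (f : 'rV[R]_d -> W) x :
  differentiable f (lsubmx x) -> differentiable (fun y => f (lsubmx y)) x.
Proof.
by move=> df; apply: differentiable_comp => //; exact: differentiable_lsubmx.
Qed.

Lemma differentiable_comp_rsubmx (f : 'rV[R]_e -> W) x :
  differentiable f (rsubmx x) -> differentiable (fun y => f (rsubmx y)) x.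
Proof.
by move=> df; apply: differentiable_comp => //; exact: differentiable_rsubmx.
Qed.

End SubmatrixDerivatives.

Section ProductC2.
Context {R : realType}.

Lemma C2_mul (V : normedModType R) (D : set V) (f g : V -> R) :
  open D -> C2 D f -> C2 D g -> C2 D (fun y => f y * g y).
Proof.
move=> oD fC gC x Dx; have [df dDf] := fC x Dx; have [dg dDg] := gC x Dx.
split=> [|v]; first exact: differentiableM.
apply: (@near_eq_differentiable _ _
    (fun y => f y * 'D_v g y + g y * 'D_v f y)).
  apply: filterS (open_nbhs_nbhs (conj oD Dx)) => y Dy.
  by rewrite derive_mul//; [case: (fC y Dy)|case: (gC y Dy)].
by apply: differentiableD; apply: differentiableM.
Qed.

Lemma C2_lsubmx d e (D : set 'rV[R]_d) (f : 'rV[R]_d -> R) :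
  C2 D f ->
  C2 [set y : 'rV[R]_(d + e) | D (lsubmx y)] (fun y => f (lsubmx y)).
Proof.
move=> fC x /fC[df dDf]; split=> [|v]; first exact: differentiable_comp_lsubmx.
have -> : 'D_v (fun y : 'rV[R]_(d + e) => f (lsubmx y)) =
    fun y => 'D_(lsubmx v) f (lsubmx y).
  by apply/funext => y; rewrite derive_lsubmx.
exact: (@differentiable_comp_lsubmx _ _ _ _ ('D_(lsubmx v) f)).
Qed.

Lemma C2_rsubmx d e (D : set 'rV[R]_e) (f : 'rV[R]_e -> R) :
  C2 D f ->
  C2 [set y : 'rV[R]_(d + e) | D (rsubmx y)] (fun y => f (rsubmx y)).
Proof.
move=> fC x /fC[df dDf]; split=> [|v]; first exact: differentiable_comp_rsubmx.
have -> : 'D_v (fun y : 'rV[R]_(d + e) => f (rsubmx y)) =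
    fun y => 'D_(rsubmx v) f (rsubmx y).
  by apply/funext => y; rewrite derive_rsubmx.
exact: (@differentiable_comp_rsubmx _ _ _ _ ('D_(rsubmx v) f)).
Qed.

Lemma C2_sub (V : normedModType R) (D D' : set V) (f : V -> R) :
  D `<=` D' -> C2 D' f -> C2 D f.
Proof. by move=> DD fC x /DD/fC. Qed.

Lemma C2_cst (V : normedModType R) (D : set V) (a : R) : C2 D (fun=> a).
Proof.
move=> x Dx; split=> [|v]; first exact: differentiable_cst.
have -> : 'D_v (fun=> a) = cst 0 :> (V -> R).
  by apply/funext => y; exact: derive_cst.
exact: differentiable_cst.
Qed.

End ProductC2.

Section Warped.
Context {R : realType} {d e : nat}.
Variables (g1 : 'rV[R]_d -> 'M[R]_d) (D1 : set 'rV[R]_d).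
Variables (g2 : 'rV[R]_e -> 'M[R]_e) (D2 : set 'rV[R]_e).
Variable (f : 'rV[R]_d -> R).
Hypotheses (g1D : local_metric g1 D1) (g2D : local_metric g2 D2).
Hypotheses (fC2 : C2 D1 f) (f_neq0 : forall x, D1 x -> f x != 0).

Let gw (y : 'rV[R]_(d + e)) : 'M[R]_(d + e) :=
  block_mx (g1 (lsubmx y)) 0 0 (f (lsubmx y) *: g2 (rsubmx y)).

Let Dw : set 'rV[R]_(d + e) := [set y | D1 (lsubmx y) /\ D2 (rsubmx y)].

Lemma inner_warped x u v : inner gw x u v =
  inner g1 (lsubmx x) (lsubmx u) (lsubmx v)
  + f (lsubmx x) * inner g2 (rsubmx x) (rsubmx u) (rsubmx v).
Proof.
rewrite /inner -{1}(hsubmxK u) -{1}(hsubmxK v) tr_row_mx mul_row_block.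
rewrite !mulmx0 addr0 add0r mul_row_col mxE; congr (_ + _).
by rewrite -scalemxAr -scalemxAl mxE.
Qed.

Lemma open_warped : open Dw.
Proof.
apply: openI.
  apply: open_comp (lm_open g1D) => y _; exact: continuous_lsubmx.
apply: open_comp (lm_open g2D) => y _; exact: continuous_rsubmx.
Qed.

Lemma local_metric_warped : local_metric gw Dw.
Proof.
have oD := open_warped.
split=> // [i j|x [Dx1 Dx2]|x [Dx1 Dx2]].
- rewrite /gw; case: (split_ordP i) => {}i ->; case: (split_ordP j) => {}j ->.
  + under eq_fun do rewrite block_mxEul.
    apply: (@C2_sub _ _ _ [set y : 'rV[R]_(d + e) | D1 (lsubmx y)]).
      by move=> y [].
    exact: C2_lsubmx (lm_C2 g1D i j).
  + under eq_fun do rewrite block_mxEur mxE; exact: C2_cst.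
  + under eq_fun do rewrite block_mxEdl mxE; exact: C2_cst.
  + under eq_fun do rewrite block_mxEdr mxE.
    apply: C2_mul => //.
      apply: (@C2_sub _ _ _ [set y : 'rV[R]_(d + e) | D1 (lsubmx y)]).
        by move=> y [].
      exact: C2_lsubmx.
    apply: (@C2_sub _ _ _ [set y : 'rV[R]_(d + e) | D2 (rsubmx y)]).
      by move=> y [].
    exact: C2_rsubmx (lm_C2 g2D i j).
- rewrite /gw tr_block_mx !trmx0 linearZ /=.
  by rewrite (lm_sym g1D Dx1) (lm_sym g2D Dx2).
- rewrite /gw unitmxE det_ublock detZ !unitrM -!unitmxE.
  by rewrite (lm_unit g1D Dx1) (lm_unit g2D Dx2) andbT unitrX// unitfE f_neq0.
Qed.

Definition warp_grad (y : 'rV[R]_d) : 'rV[R]_d :=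
  (\row_k partial k f y) *m invmx (g1 y).

(** The derivative of log(sqrt f) for positive [f]; sqrt f is the factor by which the fibre is
    stretched. *)
Definition warp_dlog (v y : 'rV[R]_d) : R := (2 * f y)^-1 * 'D_v f y.

Lemma inner_warp_grad y w : D1 y -> inner g1 y (warp_grad y) w = 'D_w f y.
Proof.
move=> Dy; have [df _] := fC2 Dy.
rewrite /inner /warp_grad mulmxKV ?(lm_unit g1D)// derive_partial// mxE.
by apply: eq_bigr => k _; rewrite !mxE mulrC.
Qed.

Lemma derive_inner_warped x u v w : Dw x ->
  'D_u (fun y => inner gw y v w) x =
  'D_(lsubmx u) (fun y => inner g1 y (lsubmx v) (lsubmx w)) (lsubmx x)
  + (f (lsubmx x) *
       'D_(rsubmx u) (fun y => inner g2 y (rsubmx v) (rsubmx w)) (rsubmx x)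
     + inner g2 (rsubmx x) (rsubmx v) (rsubmx w) * 'D_(lsubmx u) f (lsubmx x)).
Proof.
move=> [Dx1 Dx2].
have -> : (fun y => inner gw y v w) = (fun y =>
    inner g1 (lsubmx y) (lsubmx v) (lsubmx w)
    + f (lsubmx y) * inner g2 (rsubmx y) (rsubmx v) (rsubmx w)).
  by apply/funext => y; rewrite inner_warped.
have df : differentiable (fun y : 'rV[R]_(d + e) => f (lsubmx y)) x.
  by apply: differentiable_comp_lsubmx; case: (fC2 Dx1).
have d1 := @differentiable_comp_lsubmx _ _ e _ _ x
  (differentiable_inner g1D (lsubmx v) (lsubmx w) Dx1).
have d2 := @differentiable_comp_rsubmx _ d _ _ _ x
  (differentiable_inner g2D (rsubmx v) (rsubmx w) Dx2).
rewrite derive_add//; last exact: differentiableM.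
rewrite (derive_mul _ df d2).
rewrite (@derive_lsubmx _ _ _ _ (fun y => inner g1 y (lsubmx v) (lsubmx w))).
rewrite (@derive_rsubmx _ _ _ _ (fun y => inner g2 y (rsubmx v) (rsubmx w))).
by rewrite derive_lsubmx.
Qed.

(** Both sides are paired with an arbitrary [z], and the Koszul formulas of the product and of the
    two factors are compared. *)
Lemma gam_warped x v w : Dw x -> gam gw v w x =
  row_mx
    (gam g1 (lsubmx v) (lsubmx w) (lsubmx x)
     - (2^-1 * inner g2 (rsubmx x) (rsubmx v) (rsubmx w))
       *: warp_grad (lsubmx x))
    (gam g2 (rsubmx v) (rsubmx w) (rsubmx x)
     + (warp_dlog (lsubmx v) (lsubmx x) *: rsubmx w
        + warp_dlog (lsubmx w) (lsubmx x) *: rsubmx v)).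
Proof.
move=> Dx; have [Dx1 Dx2] := Dx; have lmw := local_metric_warped.
apply: (inner_inj (lm_unit lmw Dx)) => z.
rewrite (inner_gam lmw)// !derive_inner_warped// inner_warped row_mxKl row_mxKr.
rewrite innerDl innerNl innerZl inner_warp_grad// !innerDl !innerZl.
rewrite (inner_gam g1D)// (inner_gam g2D)// /warp_dlog.
have := f_neq0 Dx1; rewrite (inner_sym g2D (rsubmx v) (rsubmx z) Dx2).
rewrite (inner_sym g2D (rsubmx w) (rsubmx z) Dx2).
move: (f _) (inner g2 _ _ _) (inner g2 _ _ _) (inner g2 _ _ _) => F i1 i2 i3 F0.
do ![match goal with |- context [@derive ?K ?V ?W ?h ?y ?z] =>
  let a := fresh "a" in
  set a := (@derive K V W h y z); move: (a : R) => {}a end].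
by field.
Qed.

Lemma derive_warp_dlog y a b : D1 y -> 'D_a (warp_dlog b) y =
  (2 * f y)^-1 * 'D_a ('D_b f) y - 2 * warp_dlog a y * warp_dlog b y.
Proof.
move=> Dy; have [df dDf] := fC2 Dy; have fy := f_neq0 Dy.
have d2f : differentiable (fun y => 2 * f y) y.
  by apply: differentiableM => //; exact: differentiable_cst.
have f2 : 2 * f y != 0 by rewrite mulf_neq0.
rewrite /warp_dlog derive_mul//; last exact: differentiableV.
rewrite [X in _ + _ * X]deriveV//; last exact: diff_derivable.
rewrite derive_scale// /GRing.scale /=.
set p := 'D_a ('D_b f) y; set q := 'D_a f y; set r := 'D_b f y.
move: (f y) (p : R) (q : R) (r : R) fy => F {}p {}q {}r F0.
by field.
Qed.

Lemma differentiable_warp_dlog y a : D1 y -> differentiable (warp_dlog a) y.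
Proof.
move=> Dy; have [df dDf] := fC2 Dy.
apply: differentiableM => //; apply: differentiableV.
  by apply: differentiableM => //; exact: differentiable_cst.
by rewrite mulf_neq0// f_neq0.
Qed.

Lemma differentiable_warp_grad y : D1 y -> differentiable_row warp_grad y.
Proof.
move=> Dy k; have [df dDf] := fC2 Dy.
have E : (fun z => warp_grad z 0 k) =
    fun z => \sum_j partial j f z * invmx (g1 z) j k.
  by apply/funext => z; rewrite /warp_grad mxE; under eq_bigr do rewrite mxE.
rewrite E; apply: differentiable_bigsum => j _.
apply: differentiableM; first exact: dDf.
apply: differentiable_invmx => [|a b]; last by case: (lm_C2 g1D a b Dy).
by apply: filterS (lm_near g1D Dy) => z; exact: lm_unit.
Qed.

Definition warp_form (y a b : 'rV[R]_d) : R :=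
  (a *m warp_tensor g1 f y *m b^T) 0 0.

Lemma warp_formE y a b : D1 y -> warp_form y a b =
  'D_a ('D_b f) y - 'D_(gam g1 a b y) f y
  - (2 * f y)^-1 * ('D_a f y * 'D_b f y).
Proof.
move=> Dy; have [df dDf] := fC2 Dy.
have -> : 'D_a ('D_b f) y =
    \sum_i \sum_j a 0 i * b 0 j * partial i (partial j f) y.
  have -> : 'D_a ('D_b f) y = 'D_a (fun z => \sum_j b 0 j * partial j f z) y.
    apply: near_eq_derive; apply: filterS (lm_near g1D Dy) => z Dz.
    by rewrite derive_partial//; case: (fC2 Dz).
  rewrite derive_bigsum => [|j _]; last first.
    by apply: differentiableM; [exact: differentiable_cst|exact: dDf].
  rewrite [RHS]exchange_big /=; apply: eq_bigr => j _.
  rewrite derive_scale; last exact: dDf.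
  rewrite derive_partial; last exact: dDf.
  by rewrite mulr_sumr; apply: eq_bigr => i _; rewrite mulrCA mulrA.
rewrite !derive_partial//.
have -> : \sum_i gam g1 a b y 0 i * partial i f y =
    \sum_i \sum_j a 0 i * b 0 j * \sum_c christoffel g1 c i j y * partial c f y.
  under eq_bigr do rewrite mxE mulr_suml.
  rewrite exchange_big; apply: eq_bigr => i _ /=.
  under eq_bigr do rewrite mulr_suml.
  rewrite exchange_big; apply: eq_bigr => j _ /=.
  by rewrite mulr_sumr; apply: eq_bigr => c _; rewrite mulrA.
rewrite big_distrlr /= mulr_sumr -!sumrB /warp_form mxE.
under [LHS]eq_bigr do rewrite mxE mulr_suml.
rewrite [LHS]exchange_big; apply: eq_bigr => i _ /=.
rewrite mulr_sumr -!sumrB; apply: eq_bigr => j _; rewrite !mxE.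
set S := \sum_(_ < _) _; set p := partial i _ y; set q := partial i f y.
set r := partial j f y.
move: (p : R) (q : R) (r : R) => {}p {}q {}r; ring.
Qed.

Lemma warp_form_sym y a b : D1 y -> warp_form y a b = warp_form y b a.
Proof.
move=> Dy; rewrite (warp_formE a b Dy) (warp_formE b a Dy).
rewrite (C2_commute a b (lm_open g1D) fC2 Dy).
by rewrite (gam_sym g1D a b Dy) ['D_a f y * _]mulrC.
Qed.

(** Raising an index turns the Hessian part of T into the covariant derivative of the gradient and
    the quadratic part into a multiple of the gradient; T enters the base component of the curvature
    in this shape. *)
Lemma covariant_derive_warp_grad y a : D1 y ->
  'D_a warp_grad y + gam g1 a (warp_grad y) y
  - warp_dlog a y *: warp_grad y = a *m warp_tensor g1 f y *m invmx (g1 y).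
Proof.
move=> Dy; apply: (inner_inj (lm_unit g1D Dy)) => b.
have -> : inner g1 y (a *m warp_tensor g1 f y *m invmx (g1 y)) b =
    warp_form y a b.
  by rewrite /inner mulmxKV ?(lm_unit g1D).
rewrite innerDl innerNl innerZl innerDl inner_warp_grad// warp_formE//.
have := derive_inner_field g1D a b Dy (differentiable_warp_grad Dy).
rewrite (metric_compat g1D)// (inner_warp_grad (gam g1 a b y) Dy).
have -> : 'D_a (fun z => inner g1 z (warp_grad z) b) y = 'D_a ('D_b f) y.
  apply: near_eq_derive; apply: filterS (lm_near g1D Dy) => z Dz.
  exact: inner_warp_grad.
move=> ->; rewrite /warp_dlog.
set p := inner _ _ _ _; set q := inner _ _ _ _; set r := _^-1.
set s := 'D_a f y; set t := 'D_b f y; set z := 'D_(_) f y.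
by move: (p : R) (q : R) (r : R) (s : R) (t : R) (z : R) => *; ring.
Qed.

Lemma derive_gam_warped x u v w : Dw x -> 'D_u (gam gw v w) x =
  row_mx
    ('D_(lsubmx u) (gam g1 (lsubmx v) (lsubmx w)) (lsubmx x)
     - ((2^-1 * inner g2 (rsubmx x) (rsubmx v) (rsubmx w))
          *: 'D_(lsubmx u) warp_grad (lsubmx x)
        + (2^-1 * 'D_(rsubmx u)
             (fun y => inner g2 y (rsubmx v) (rsubmx w)) (rsubmx x))
          *: warp_grad (lsubmx x)))
    ('D_(rsubmx u) (gam g2 (rsubmx v) (rsubmx w)) (rsubmx x)
     + ('D_(lsubmx u) (warp_dlog (lsubmx v)) (lsubmx x) *: rsubmx w
        + 'D_(lsubmx u) (warp_dlog (lsubmx w)) (lsubmx x) *: rsubmx v)).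
Proof.
move=> Dx; have [Dx1 Dx2] := Dx; have lmw := local_metric_warped.
have dG1 := differentiable_gam g1D (lsubmx v) (lsubmx w) Dx1.
have dG2 := differentiable_gam g2D (rsubmx v) (rsubmx w) Dx2.
have dg := differentiable_warp_grad Dx1.
have dl := fun a => differentiable_warp_dlog a Dx1.
have di := differentiable_inner g2D (rsubmx v) (rsubmx w) Dx2.
have dW := differentiable_gam lmw v w Dx.
apply/rowP => k; rewrite (derive_row u k dW).
case: (split_ordP k) => {}k ->; [rewrite row_mxEl|rewrite row_mxEr].
  transitivity ('D_u (fun y => gam g1 (lsubmx v) (lsubmx w) (lsubmx y) 0 k
      + (- 2^-1) * (inner g2 (rsubmx y) (rsubmx v) (rsubmx w)
                    * warp_grad (lsubmx y) 0 k)) x).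
    apply: near_eq_derive; apply: filterS (lm_near lmw Dx) => y Dy.
    rewrite gam_warped// row_mxEl; set s := gam g1 _ _ _.
    by rewrite !mxE; ring.
  have d1 := @differentiable_comp_lsubmx _ _ e _ _ x (dG1 k).
  have d2 := @differentiable_comp_lsubmx _ _ e _ _ x (dg k).
  have d3 := @differentiable_comp_rsubmx _ d _ _ _ x di.
  rewrite (derive_add _ d1); last first.
    apply: differentiableM; first exact: differentiable_cst.
    exact: differentiableM.
  rewrite derive_scale; last exact: differentiableM.
  rewrite (derive_mul _ d3 d2).
  rewrite (@derive_lsubmx _ _ _ _
    (fun y => gam g1 (lsubmx v) (lsubmx w) y 0 k)).
  rewrite (@derive_lsubmx _ _ _ _ (fun y => warp_grad y 0 k)).
  rewrite (@derive_rsubmx _ _ _ _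
    (fun y => inner g2 y (rsubmx v) (rsubmx w))).
  rewrite -(derive_row _ _ dG1) -(derive_row _ _ dg).
  set p := 'D_(lsubmx u) (gam g1 _ _) _; set q := 'D_(lsubmx u) warp_grad _.
  set r := 'D_(rsubmx u) _ _; set s := warp_grad _; set t := inner _ _ _ _.
  move: (p : 'rV_d) (q : 'rV_d) (r : R) (s : 'rV_d) (t : R).
  by move=> {}p {}q {}r {}s {}t; rewrite !mxE; ring.
transitivity ('D_u (fun y => gam g2 (rsubmx v) (rsubmx w) (rsubmx y) 0 k
    + (rsubmx w 0 k * warp_dlog (lsubmx v) (lsubmx y)
       + rsubmx v 0 k * warp_dlog (lsubmx w) (lsubmx y))) x).
  apply: near_eq_derive; apply: filterS (lm_near lmw Dx) => y Dy.
  rewrite gam_warped// row_mxEr; set s := gam g2 _ _ _.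
  by move: (rsubmx v) (rsubmx w) s => v2 w2 s; rewrite !mxE; ring.
have d1 := @differentiable_comp_rsubmx _ d _ _ _ x (dG2 k).
have d2 a := @differentiable_comp_lsubmx _ _ e _ _ x (dl a).
have d3 a b : differentiable (fun y : 'rV[R]_(d + e) =>
    a * warp_dlog b (lsubmx y)) x.
  apply: differentiableM => //; exact: differentiable_cst.
rewrite (derive_add _ d1); last exact: differentiableD.
rewrite (derive_add _ (d3 _ _) (d3 _ _)) !(derive_scale _ _ (d2 _)).
rewrite (@derive_rsubmx _ _ _ _ (fun y => gam g2 (rsubmx v) (rsubmx w) y 0 k)).
rewrite !(@derive_lsubmx _ _ _ _ (warp_dlog _)).
rewrite -(derive_row _ _ dG2).
set p := 'D_(rsubmx u) (gam g2 _ _) _; set q := 'D_(lsubmx u) _ _.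
set r := 'D_(lsubmx u) _ _.
move: (rsubmx v) (rsubmx w) (p : 'rV_e) (q : R) (r : R) => v2 w2 {}p {}q {}r.
by rewrite !mxE; ring.
Qed.

Lemma warp_dlog_linear y (s : R) a b : D1 y ->
  warp_dlog (s *: a + b) y = s * warp_dlog a y + warp_dlog b y.
Proof.
move=> Dy; have [df _] := fC2 Dy.
rewrite /warp_dlog derive_differentiable_linear//.
set p := 'D_a f y; set q := 'D_b f y; set r := _^-1.
by move: (p : R) (q : R) (r : R) => *; ring.
Qed.

Lemma derive_warp_dlog_sym y a b : D1 y ->
  'D_a (warp_dlog b) y = 'D_b (warp_dlog a) y.
Proof.
move=> Dy; rewrite (derive_warp_dlog a b Dy) (derive_warp_dlog b a Dy).
by rewrite (C2_commute a b (lm_open g1D) fC2 Dy) mulrAC.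
Qed.

(** The identity Hess(phi) / phi = Hess(log phi) + (d log phi)^2 with phi = sqrt f; T enters the
    fibre component in this shape. *)
Lemma warp_form_dlog y a b : D1 y -> (2 * f y)^-1 * warp_form y a b =
  'D_a (warp_dlog b) y - warp_dlog (gam g1 a b y) y
  + warp_dlog a y * warp_dlog b y.
Proof.
move=> Dy; rewrite derive_warp_dlog// warp_formE// /warp_dlog.
have := f_neq0 Dy; move: (f y) => F F0.
set p := 'D_a ('D_b f) y; set q := 'D_a f y; set r := 'D_b f y.
set s := 'D_(_) f y.
by move: (p : R) (q : R) (r : R) (s : R) => {}p {}q {}r {}s; field.
Qed.

(** Valid for factors of any dimension. The coefficient [2^-1 * warp_dlog (warp_grad x1) x1] is
    |grad f|^2 / (4 f). *)
Lemma curv_op_warped x u v w : Dw x ->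
  let x1 := lsubmx x in let x2 := rsubmx x in
  let h := inner g2 x2 in
  let S := warp_tensor g1 f x1 *m invmx (g1 x1) in
  curv_op gw x u v w =
  row_mx
    (curv_op g1 x1 (lsubmx u) (lsubmx v) (lsubmx w)
     - (2^-1 * h (rsubmx v) (rsubmx w)) *: (lsubmx u *m S)
     + (2^-1 * h (rsubmx u) (rsubmx w)) *: (lsubmx v *m S))
    (curv_op g2 x2 (rsubmx u) (rsubmx v) (rsubmx w)
     - (2^-1 * warp_dlog (warp_grad x1) x1)
       *: (h (rsubmx v) (rsubmx w) *: rsubmx u
           - h (rsubmx u) (rsubmx w) *: rsubmx v)
     - ((2 * f x1)^-1 * warp_form x1 (lsubmx v) (lsubmx w)) *: rsubmx u
     + ((2 * f x1)^-1 * warp_form x1 (lsubmx u) (lsubmx w)) *: rsubmx v).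
Proof.
move=> Dx x1 x2 h S; have [Dx1 Dx2] := Dx.
rewrite curv_opE !derive_gam_warped// !gam_warped//.
rewrite !(row_mxKl, row_mxKr) -/x1 -/x2.
move: (lsubmx u) (lsubmx v) (lsubmx w) (rsubmx u) (rsubmx v) (rsubmx w).
move=> u1 v1 w1 u2 v2 w2.
(* T is expanded back into covariant derivatives, so that both sides are written in the same
   derivatives of [gam], [warp_grad] and [warp_dlog]. *)
rewrite !mulmxA -!covariant_derive_warp_grad// !curv_opE.
rewrite !(metric_compat g2D)// /h.
have {}Dx2 : D2 x2 := Dx2; have {}Dx1 : D1 x1 := Dx1.
have gB (d' : nat) (g : 'rV[R]_d' -> 'M[R]_d') z a b c t :
    gam g a (b - t *: c) z = gam g a b z - t *: gam g a c z.
  by rewrite addrC -scaleNr gam_linearr addrC scaleNr.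
have gD (d' : nat) (g : 'rV[R]_d' -> 'M[R]_d') z a b c p t q :
    gam g a (b + (p *: c + t *: q)) z =
    gam g a b z + (p *: gam g a c z + t *: gam g a q z).
  rewrite -{1}[b]scale1r gam_linearr scale1r gam_linearr.
  by rewrite -{1}[_ *: q]addr0 gam_linearr gam0r addr0.
have lB b c t : warp_dlog (b - t *: c) x1 =
    warp_dlog b x1 - t * warp_dlog c x1.
  by rewrite addrC -scaleNr warp_dlog_linear// addrC mulNr.
rewrite !gB !gD !lB !innerDr !innerZr !warp_form_dlog//.
(* The cancellations between the halves with [u] and [v] exchanged use the symmetry of second
   derivatives of log f, of [gam g2] and of [g2]. *)
rewrite (derive_warp_dlog_sym v1 u1 Dx1).
rewrite (gam_sym g2D v2 u2 Dx2) (inner_sym g2D v2 u2 Dx2).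
rewrite (inner_sym g2D (gam g2 u2 v2 x2) w2 Dx2).
rewrite !add_row_mx opp_row_mx add_row_mx.
move: ('D_u1 (gam g1 v1 w1) x1 : 'rV_d) ('D_v1 (gam g1 u1 w1) x1 : 'rV_d).
move: ('D_u1 warp_grad x1 : 'rV_d) ('D_v1 warp_grad x1 : 'rV_d).
move: ('D_u2 (gam g2 v2 w2) x2 : 'rV_e) ('D_v2 (gam g2 u2 w2) x2 : 'rV_e).
move: ('D_u1 (warp_dlog v1) x1 : R) ('D_u1 (warp_dlog w1) x1 : R).
move: ('D_v1 (warp_dlog w1) x1 : R) => a1 a2 a3 a4 a5 a6 a7 a8 a9.
do ![match goal with |- context [warp_dlog ?y ?z] =>
  move: (warp_dlog y z) => ? end].
do ![match goal with |- context [inner ?g ?y ?z ?t] =>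
  move: (inner g y z t) => ? end].
do ![match goal with |- context [gam ?g ?y ?z ?t] =>
  move: (gam g y z t) => ? end].
move: (warp_grad x1) => ?.
by congr row_mx; apply/rowP => k; rewrite !mxE; field.
Qed.
End Warped.

(** * Pointwise algebra *)

(* For a matrix [A], [inner (fun=> A) 0] is the bilinear form of [A]. *)

Lemma inner_delta (R : realType) d (g : 'rV[R]_d -> 'M[R]_d) x i j :
  inner g x 'e_i 'e_j = g x i j.
Proof. by rewrite /inner trmx_delta -rowE -colE !mxE. Qed.

Lemma sum_inner_delta (R : realType) d (g : 'rV[R]_d -> 'M[R]_d) x
    (u v : 'rV[R]_d) :
  \sum_i inner g x 'e_i v * u 0 i = inner g x u v.
Proof.
rewrite [in RHS](row_sum_delta u) /inner !mulmx_suml summxE.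
by apply: eq_bigr => i _; rewrite -!scalemxAl [RHS]mxE mulrC.
Qed.

Lemma sum_invmx_mul (R : realType) d (A B : 'M[R]_d) : B^T = B ->
  \sum_i \sum_j invmx A i j * B i j = \tr (B *m invmx A).
Proof.
move=> Bs; rewrite mxtrace_mulC; apply: eq_bigr => i _; rewrite mxE.
by apply: eq_bigr => j _; rewrite -{1}Bs mxE.
Qed.

(** P /\ G is skew in each pair, so by [skew_form4] one value decides; there the inverse of [G] is
    written with cofactors. *)
Lemma kn_form2 (R : realType) (G P : 'M[R]_2) (u1 u2 u3 u4 : 'rV[R]_2) :
  G^T = G -> P^T = P -> G \in unitmx ->
  let B := inner (fun=> G) 0 in let Q := inner (fun=> P) 0 in
  B u1 u4 * Q u2 u3 + B u2 u3 * Q u1 u4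
  - B u1 u3 * Q u2 u4 - B u2 u4 * Q u1 u3 =
  \tr (P *m invmx G) * (B u1 u4 * B u2 u3 - B u1 u3 * B u2 u4).
Proof.
move=> Gs Ps uG B Q.
pose k u1 u2 u3 u4 := B u1 u4 * Q u2 u3 + B u2 u3 * Q u1 u4
  - B u1 u3 * Q u2 u4 - B u2 u4 * Q u1 u3.
rewrite -/(k u1 u2 u3 u4) (@skew_form4 _ k); first last.
- by move=> *; rewrite /k; ring.
- by move=> *; rewrite /k; ring.
- by move=> *; rewrite /k /B /Q !inner_lin; ring.
- by move=> *; rewrite /k /B /Q !inner_lin; ring.
rewrite -[X in _ = _ * X]/(gtensor (fun=> G) 0 u1 u2 u3 u4).
rewrite gtensor_skew_form4 [RHS]mulrCA; congr (_ * _).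
rewrite /k /gtensor /B /Q !inner_delta.
have detG : \det G != 0 by rewrite -unitfE -unitmxE.
have G10 : G 1 0 = G 0 1 by rewrite -{1}Gs mxE.
have P10 : P 1 0 = P 0 1 by rewrite -{1}Ps mxE.
rewrite -sum_invmx_mul// /invmx uG.
have i1 : lift ord0 ord0 = 1 :> 'I_2 by exact: val_inj.
have i0 : lift 1 ord0 = 0 :> 'I_2 by exact: val_inj.
rewrite !big_ord_recl !big_ord0 !mxE /cofactor !det_mx11 !mxE.
rewrite i1 i0 /= G10 P10.
move: detG; rewrite det_matrix2 G10 => detG.
by field.
Qed.

Section PointwiseAlgebra.
Context {R : realType} {e : nat}.
Variables (G P : 'M[R]_2) (H : 'M[R]_e) (K c : R).
Variables (g : 'rV[R]_(2 + e) -> 'M[R]_(2 + e)) (x : 'rV[R]_(2 + e)).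
Hypotheses (Gs : G^T = G) (Ps : P^T = P) (Hs : H^T = H).
Hypotheses (uG : G \in unitmx) (uH : H \in unitmx).
Hypothesis e_gt1 : (1 < e)%N.
Hypothesis gE : g x = block_mx G 0 0 H.

Let B (u v : 'rV[R]_(2 + e)) := inner (fun=> G) 0 (lsubmx u) (lsubmx v).
Let Q (u v : 'rV[R]_(2 + e)) := inner (fun=> P) 0 (lsubmx u) (lsubmx v).
Let h (u v : 'rV[R]_(2 + e)) := inner (fun=> H) 0 (rsubmx u) (rsubmx v).

(** The decomposition of the curvature in operator form, at one point. [P *m invmx G], acting on row
    vectors from the right, is the endomorphism of [P]; [H] contains the warping factor. *)
Hypothesis curvE : forall u v w, curv_op g x u v w =
  row_mx
    (K *: (B v w *: lsubmx u - B u w *: lsubmx v)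
     + (h v w *: (lsubmx u *m (P *m invmx G))
        - h u w *: (lsubmx v *m (P *m invmx G))))
    (c *: (h v w *: rsubmx u - h u w *: rsubmx v)
     + (Q v w *: rsubmx u - Q u w *: rsubmx v)).

Let inner_cst_sym d (A : 'M[R]_d) u v : A^T = A ->
  inner (fun=> A) 0 u v = inner (fun=> A) 0 v u.
Proof.
move=> As; rewrite /inner -[in RHS]As -[v in RHS]trmxK.
by rewrite -!trmx_mul [RHS]mxE mulmxA.
Qed.

Let Bs u v : B u v = B v u. Proof. exact: inner_cst_sym. Qed.
Let Qs u v : Q u v = Q v u. Proof. exact: inner_cst_sym. Qed.
Let hs u v : h u v = h v u. Proof. exact: inner_cst_sym. Qed.

Let innerE u v : inner g x u v = B u v + h u v.
Proof.
rewrite /inner gE -{1}(hsubmxK u) -{1}(hsubmxK v) tr_row_mx mul_row_block.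
by rewrite !mulmx0 addr0 add0r mul_row_col [LHS]mxE.
Qed.

Let inner_sharp (a b : 'rV[R]_2) :
  inner (fun=> G) 0 (a *m (P *m invmx G)) b = inner (fun=> P) 0 a b.
Proof. by rewrite /inner mulmxA mulmxKV. Qed.

Let B_curv u v w z : B (curv_op g x u v w) z =
  K * (B v w * B u z - B u w * B v z) + (h v w * Q u z - h u w * Q v z).
Proof.
rewrite curvE /B row_mxKl.
by rewrite !(innerDl, innerNl, innerZl) !inner_sharp.
Qed.

Let h_curv u v w z : h (curv_op g x u v w) z =
  c * (h v w * h u z - h u w * h v z) + (Q v w * h u z - Q u w * h v z).
Proof.
by rewrite curvE /h row_mxKr !(innerDl, innerNl, innerZl).
Qed.

Lemma riem_block u v w z : riem g x u v w z =
  K * (B v w * B u z - B u w * B v z) + c * (h v w * h u z - h u w * h v z)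
  + (h v w * Q u z - h u w * Q v z + (Q v w * h u z - Q u w * h v z)).
Proof. rewrite /riem innerE B_curv h_curv; ring. Qed.

Let B_wedge u v w z : B (wedge_op g x u v w) z =
  inner g x v w * B u z - inner g x u w * B v z.
Proof.
by rewrite /wedge_op /B linearB !linearZ /= !(innerDl, innerNl, innerZl).
Qed.

Let h_wedge u v w z : h (wedge_op g x u v w) z =
  inner g x v w * h u z - inner g x u w * h v z.
Proof.
by rewrite /wedge_op /h linearB !linearZ /= !(innerDl, innerNl, innerZl).
Qed.

Let Q_wedge u v w z : Q (wedge_op g x u v w) z =
  inner g x v w * Q u z - inner g x u w * Q v z.
Proof.
by rewrite /wedge_op /Q linearB !linearZ /= !(innerDl, innerNl, innerZl).
Qed.

(** The form of the square of the endomorphism of [P], which arises when [Q] meets a curvature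
    vector. *)
Let Qsharp (u v : 'rV[R]_(2 + e)) :=
  inner (fun=> P) 0 (lsubmx u *m (P *m invmx G)) (lsubmx v).

Let Q_curv u v w z : Q (curv_op g x u v w) z =
  K * (B v w * Q u z - B u w * Q v z)
  + (h v w * Qsharp u z - h u w * Qsharp v z).
Proof.
by rewrite curvE /Q row_mxKl !(innerDl, innerNl, innerZl).
Qed.

(** The forms of [P] and of its square become multiples of [B], and the claim a polynomial identity
    in the values of [B] and [h] on six vectors. *)
Lemma pseudosymmetric_block L : P = L *: G -> forall u1 u2 u3 u4 u v,
  RdotR g x u1 u2 u3 u4 u v = L * QgR g x u1 u2 u3 u4 u v.
Proof.
move=> PL u1 u2 u3 u4 u v.
have QB a b : Q a b = L * B a b.
  by rewrite /Q /B /inner PL -scalemxAr -scalemxAl mxE.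
have QBs a b : Qsharp a b = L * (L * B a b).
  have PG : P *m invmx G = L%:M by rewrite PL -scalemxAl mulmxV// scalemx1.
  by rewrite /Qsharp PG mul_mx_scalar innerZl -/(Q a b) QB.
rewrite /RdotR /QgR /riem_act !riem_block.
rewrite !(B_curv, h_curv, Q_curv, B_wedge, h_wedge, Q_wedge).
(* Operators in a right-hand slot are moved to the left, where the evaluation rules apply. *)
rewrite !(Bs _ (curv_op _ _ _ _ _), Bs _ (wedge_op _ _ _ _ _)).
rewrite !(hs _ (curv_op _ _ _ _ _), hs _ (wedge_op _ _ _ _ _)).
rewrite !(Qs _ (curv_op _ _ _ _ _), Qs _ (wedge_op _ _ _ _ _)).
rewrite !(B_curv, h_curv, Q_curv, B_wedge, h_wedge, Q_wedge).
rewrite !innerE !(QB, QBs).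
(* Arguments are sorted so that [ring] sees equal values as one atom. *)
rewrite !(Bs u2 u1, Bs u3 u1, Bs u4 u1, Bs u u1, Bs v u1, Bs u3 u2, Bs u4 u2,
  Bs u u2, Bs v u2, Bs u4 u3, Bs u u3, Bs v u3, Bs u u4, Bs v u4, Bs v u).
rewrite !(hs u2 u1, hs u3 u1, hs u4 u1, hs u u1, hs v u1, hs u3 u2, hs u4 u2,
  hs u u2, hs v u2, hs u4 u3, hs u u3, hs v u3, hs u u4, hs v u4, hs v u).
ring.
Qed.

Let B_row a b a' b' : B (row_mx a b) (row_mx a' b') = inner (fun=> G) 0 a a'.
Proof. by rewrite /B !row_mxKl. Qed.

Let Q_row a b a' b' : Q (row_mx a b) (row_mx a' b') = inner (fun=> P) 0 a a'.
Proof. by rewrite /Q !row_mxKl. Qed.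

Let h_row a b a' b' : h (row_mx a b) (row_mx a' b') = inner (fun=> H) 0 b b'.
Proof. by rewrite /h !row_mxKr. Qed.

Let Qsharp_row a b a' b' : Qsharp (row_mx a b) (row_mx a' b') =
  inner (fun=> P) 0 (a *m (P *m invmx G)) a'.
Proof. by rewrite /Qsharp !row_mxKl. Qed.

(** ['e_i *m invmx A] is a vector of the basis dual to the standard one for [A]; it serves in place
    of orthonormal vectors. *)
Let inner_dual d (A : 'M[R]_d) u i : A^T = A -> A \in unitmx ->
  inner (fun=> A) 0 u ('e_i *m invmx A) = u 0 i.
Proof.
move=> As uA; rewrite /inner trmx_mul trmx_inv As mulmxA mulmxK//.
by rewrite trmx_delta -colE mxE.
Qed.

Lemma pseudosymmetric_block_inv L :
  (forall u1 u2 u3 u4 u v,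
    RdotR g x u1 u2 u3 u4 u v = L * QgR g x u1 u2 u3 u4 u v) ->
  (\tr (P *m invmx G) - (K + c)) *: (P - L *: G) = 0.
Proof.
move=> RL; pose p := inner (fun=> P) 0; pose y := inner (fun=> G) 0.
pose s (a : 'rV_2) := a *m (P *m invmx G); pose q a b := p a b - L * y a b.
(* Two fibre indices, 0 and 1, because [Er] takes two dual pairs. *)
have /ltnW e0 := e_gt1; pose i0 := Ordinal e0; pose i1 := Ordinal e_gt1.
have ei : inner (fun=> H) 0 'e_i0 ('e_i0 *m invmx H) = 1.
  by rewrite inner_dual// mxE !eqxx.
have ej : inner (fun=> H) 0 'e_i1 ('e_i1 *m invmx H) = 1.
  by rewrite inner_dual// mxE !eqxx.
have eij : inner (fun=> H) 0 'e_i0 ('e_i1 *m invmx H) = 0.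
  by rewrite inner_dual// mxE.
have eji : inner (fun=> H) 0 'e_i1 ('e_i0 *m invmx H) = 0.
  by rewrite inner_dual// mxE.
(* [u] and [u1] are a fibre vector and its dual, paired to 1 by [h]; the other four vectors lie in
   the base. *)
have Eq a b c' d :
    q a d * (p b c' - K * y b c') = q a c' * (p b d - K * y b d).
  have := RL (row_mx 0 ('e_i0 *m invmx H)) (row_mx b 0) (row_mx c' 0)
    (row_mx d 0) (row_mx 0 'e_i0) (row_mx a 0).
  (* The vectors stay abstract while the action is expanded; once they are put back, all products of
     base and fibre parts vanish. *)
  move E1: (row_mx 0 ('e_i0 *m _)) => u1; move E2: (row_mx b 0) => u2.
  move E3: (row_mx c' 0) => u3; move E4: (row_mx d 0) => u4.
  move E5: (row_mx 0 'e_i0) => u; move E6: (row_mx a 0) => v.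
  rewrite /RdotR /QgR /riem_act !riem_block.
  rewrite !(B_curv, h_curv, Q_curv, B_wedge, h_wedge, Q_wedge).
  rewrite !(Bs _ (curv_op _ _ _ _ _), Bs _ (wedge_op _ _ _ _ _)).
  rewrite !(hs _ (curv_op _ _ _ _ _), hs _ (wedge_op _ _ _ _ _)).
  rewrite !(Qs _ (curv_op _ _ _ _ _), Qs _ (wedge_op _ _ _ _ _)).
  rewrite !(B_curv, h_curv, Q_curv, B_wedge, h_wedge, Q_wedge) !innerE.
  rewrite -{}E1 -{}E2 -{}E3 -{}E4 -{}E5 -{}E6.
  rewrite !(B_row, h_row, Q_row, Qsharp_row) !(inner0l, inner0r) ei.
  rewrite /q /p /y; lra.
(* Two dual fibre pairs, [u] with [u4] and [u2] with [u3]. The right-hand side is [q (s a) b]. *)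
have Er a b : c * q a b = p (s a) b - L * p a b.
  have := RL (row_mx b 0) (row_mx 0 'e_i1) (row_mx 0 ('e_i1 *m invmx H))
    (row_mx 0 ('e_i0 *m invmx H)) (row_mx 0 'e_i0) (row_mx a 0).
  move E1: (row_mx b 0) => u1; move E2: (row_mx 0 'e_i1) => u2.
  move E3: (row_mx 0 ('e_i1 *m _)) => u3.
  move E4: (row_mx 0 ('e_i0 *m _)) => u4.
  move E5: (row_mx 0 'e_i0) => u; move E6: (row_mx a 0) => v.
  rewrite /RdotR /QgR /riem_act !riem_block.
  rewrite !(B_curv, h_curv, Q_curv, B_wedge, h_wedge, Q_wedge).
  rewrite !(Bs _ (curv_op _ _ _ _ _), Bs _ (wedge_op _ _ _ _ _)).
  rewrite !(hs _ (curv_op _ _ _ _ _), hs _ (wedge_op _ _ _ _ _)).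
  rewrite !(Qs _ (curv_op _ _ _ _ _), Qs _ (wedge_op _ _ _ _ _)).
  rewrite !(B_curv, h_curv, Q_curv, B_wedge, h_wedge, Q_wedge) !innerE.
  rewrite -{}E1 -{}E2 -{}E3 -{}E4 -{}E5 -{}E6.
  rewrite !(B_row, h_row, Q_row, Qsharp_row) !(inner0l, inner0r).
  rewrite !(ei, ej, eij, eji) /q /p /y /s; lra.
have tr_form (A : 'M[R]_2) :
    \sum_i inner (fun=> A) 0 'e_i ('e_i *m invmx G) = \tr (A *m invmx G).
  apply: eq_bigr => i _.
  rewrite /inner trmx_mul trmx_inv Gs trmx_delta mulmxA -colE -mulmxA -rowE.
  by rewrite !mxE.
(* [Eq] is summed with [b] and [c'] running through a basis and its dual; 2 is the trace of the
   identity of the base. *)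
have E4 a d : q a d * (\tr (P *m invmx G) - K * 2) = (c - K) * q a d.
  have -> : \tr (P *m invmx G) - K * 2 = \sum_i (p 'e_i ('e_i *m invmx G)
      - K * y 'e_i ('e_i *m invmx G)).
    by rewrite sumrB -mulr_sumr /p /y !tr_form mulmxV// mxtrace1.
  rewrite mulr_sumr; under eq_bigr do rewrite Eq.
  (* Dual vectors read off coordinates, so the sum becomes P - K G evaluated at [s a - L *: a] and
     [d]. *)
  have qi i : q a ('e_i *m invmx G) = (s a - L *: a) 0 i.
    rewrite /q /y inner_dual// [RHS]mxE; congr (_ + _); last by rewrite !mxE.
    by rewrite /p /inner trmx_mul trmx_inv Gs trmx_delta /s !mulmxA -colE mxE.
  under eq_bigr do rewrite qi mulrC mulrBl -mulrA.
  rewrite sumrB -mulr_sumr /p /y !sum_inner_delta.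
  rewrite !(innerDl, innerNl, innerZl) /s inner_sharp mulrBl.
  have := Er a d; rewrite /q /p /y /s => ->; ring.
have {}E4 a b : (\tr (P *m invmx G) - (K + c)) * q a b = 0.
  by have := E4 a b; lra.
apply/matrixP => i j; have := E4 'e_i 'e_j.
by rewrite /q /p /y !inner_delta !mxE.
Qed.

Let t := \tr (P *m invmx G).

Let delta_lshiftE i : 'e_(lshift e i) = row_mx 'e_i 0 :> 'rV[R]_(2 + e).
Proof.
apply/rowP => j; rewrite !mxE; case: (split_ordP j) => k ->.
  by rewrite !mxE (inj_eq (@lshift_inj 2 e)).
by rewrite !mxE eq_rlshift.
Qed.

Let delta_rshiftE i : 'e_(rshift 2 i) = row_mx 0 'e_i :> 'rV[R]_(2 + e).
Proof.
apply/rowP => j; rewrite !mxE; case: (split_ordP j) => k ->.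
  by rewrite !mxE eq_lrshift.
by rewrite !mxE (inj_eq (@rshift_inj 2 e)).
Qed.

(** The trace splits into base and fibre directions: the base gives K (2 - 1) and t, the fibre e and
    (e - 1) c. *)
Lemma ricci_block u v : ricci g x u v =
  K * B u v + e%:R * Q u v + (t + (e%:R - 1) * c) * h u v.
Proof.
rewrite /ricci /mxtrace big_split_ord /=.
have -> : \sum_(i < 2) lin1_mx (fun w => curv_op g x w u v)
      (lshift e i) (lshift e i) = K * B u v + t * h u v.
  transitivity (\sum_(i < 2) (K * (B u v - inner (fun=> G) 0 'e_i (lsubmx v)
      * lsubmx u 0 i) + h u v * (P *m invmx G) i i)).
    apply: eq_bigr => i _; rewrite mxE curvE row_mxEl.
    rewrite delta_lshiftE /B /h row_mxKl row_mxKr inner0l scale0r subr0.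
    by rewrite -rowE !mxE !eqxx /= !mulr1.
  rewrite big_split /= -!mulr_sumr sumrB sum_inner_delta sumr_const card_ord.
  have -> : \sum_(i < 2) (P *m invmx G) i i = t by [].
  rewrite -[inner _ _ _ _]/(B u v).
  ring.
have -> : \sum_(i < e) lin1_mx (fun w => curv_op g x w u v)
      (rshift 2 i) (rshift 2 i) = e%:R * Q u v + (e%:R - 1) * c * h u v.
  transitivity (\sum_(i < e) (c * (h u v - inner (fun=> H) 0 'e_i (rsubmx v)
      * rsubmx u 0 i) + Q u v)).
    apply: eq_bigr => i _; rewrite mxE curvE row_mxEr.
    rewrite delta_rshiftE /Q /h row_mxKl row_mxKr inner0l scale0r subr0.
    by rewrite !mxE !eqxx /= !mulr1.
  rewrite big_split /= -!mulr_sumr sumrB sum_inner_delta !sumr_const !card_ord.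
  rewrite -[inner _ _ _ _]/(h u v) -(mulr_natl (h u v)) -(mulr_natl (Q u v)).
  ring.
ring.
Qed.

Lemma scal_block : scal g x = 2 * K + e%:R * t + e%:R * (t + (e%:R - 1) * c).
Proof.
have ic : invmx (g x) = block_mx (invmx G) 0 0 (invmx H).
  by rewrite gE invmx_block_diag// unitmxE det_ublock unitrM -!unitmxE uG.
rewrite /scal big_split_ord /=.
have -> : \sum_(i < 2) \sum_j invmx (g x) (lshift e i) j *
    ricci g x 'e_(lshift e i) 'e_j = 2 * K + e%:R * t.
  transitivity (\sum_(i < 2) \sum_j
      invmx G i j * (K *: G + e%:R *: P) i j).
    apply: eq_bigr => i _; rewrite big_split_ord /= [X in _ + X]big1 => [|j _].
      rewrite addr0; apply: eq_bigr => j _.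
      rewrite ic block_mxEul ricci_block !delta_lshiftE B_row Q_row h_row.
      by rewrite inner0l !inner_delta !mxE mulr0 addr0.
    by rewrite ic block_mxEur mxE mul0r.
  rewrite sum_invmx_mul; last by rewrite linearD !linearZ /= Gs Ps.
  rewrite mulmxDl -!scalemxAl mulmxV// linearD !linearZ /= mxtrace1 -/t.
  by rewrite mulrC.
have -> : \sum_(i < e) \sum_j invmx (g x) (rshift 2 i) j *
    ricci g x 'e_(rshift 2 i) 'e_j = e%:R * (t + (e%:R - 1) * c).
  transitivity (\sum_(i < e) \sum_j
      invmx H i j * ((t + (e%:R - 1) * c) *: H) i j).
    apply: eq_bigr => i _; rewrite big_split_ord /= big1 => [|j _].
      rewrite add0r; apply: eq_bigr => j _.
      rewrite ic block_mxEdr ricci_block !delta_rshiftE B_row Q_row h_row.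
      by rewrite !inner0l !inner_delta !mxE !mulr0 !add0r.
    by rewrite ic block_mxEdl mxE mul0r.
  rewrite sum_invmx_mul; last by rewrite linearZ /= Hs.
  by rewrite -scalemxAl mulmxV// linearZ /= mxtrace1 mulrC.
by [].
Qed.

(** As n - 2 = e, the terms P /\ h of the curvature and of its Ricci part cancel, and [kn_form2]
    turns P /\ gbar into t G(gbar). For t = K + c the scalar curvature is (e + 1)(2 K + e c), and
    the coefficients of G(gbar), gbar /\ h and G(h) all vanish. *)
Lemma weyl_block u1 u2 u3 u4 : t = K + c -> weyl g x u1 u2 u3 u4 = 0.
Proof.
move=> tE.
have kn := @kn_form2 R G P (lsubmx u1) (lsubmx u2) (lsubmx u3) (lsubmx u4)
  Gs Ps uG.
rewrite /= -/t -/(B u1 u4) -/(B u2 u3) -/(B u1 u3) -/(B u2 u4) in kn.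
rewrite -/(Q u1 u4) -/(Q u2 u3) -/(Q u1 u3) -/(Q u2 u4) in kn.
rewrite /weyl /kn_ricci /gtensor riem_block scal_block !ricci_block !innerE.
rewrite natrD.
have e0 : e%:R != 0 :> R by rewrite pnatr_eq0 -lt0n ltnW.
have e1 : 1 + e%:R != 0 :> R by rewrite addrC natr1 pnatr_eq0.
rewrite tE in kn *; move: kn.
move: (B u1 u4) (B u2 u3) (B u1 u3) (B u2 u4) => b14 b23 b13 b24.
move: (Q u1 u4) (Q u2 u3) (Q u1 u3) (Q u2 u4) => q14 q23 q13 q24.
move: (h u1 u4) (h u2 u3) (h u1 u3) (h u2 u4) => h14 h23 h13 h24 /eqP.
rewrite -subr_eq0 => /eqP kn.
(* The Weyl tensor is identically minus the vanishing expression in [kn]. *)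
rewrite -[RHS]oppr0 -kn.
field.
have -> : 2 + e%:R - 2 = e%:R :> R by ring.
have -> : 2 + e%:R - 1 = 1 + e%:R :> R by ring.
by rewrite e0.
Qed.

End PointwiseAlgebra.

Lemma curv_op_constant (R : realType) d (g : 'rV[R]_d -> 'M[R]_d) x (k : R) :
  g x \in unitmx ->
  (forall u v w z, riem g x u v w z = k * gtensor g x u v w z) ->
  forall u v w, curv_op g x u v w =
    k *: (inner g x v w *: u - inner g x u w *: v).
Proof.
move=> ug E u v w; apply: (inner_inj ug) => z.
rewrite -[LHS]/(riem g x u v w z) E /gtensor !(innerDl, innerNl, innerZl).
by congr (_ * (_ - _)); rewrite mulrC.
Qed.

(** * From charts to the algebra at one point *)

Lemma local_metric_chart (R : realType) d (M : manifold R d)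
    (gM : semi_riemannian M) (c : chart R M d) :
  atlas c -> local_metric (gcomp gM c) (cimg c).
Proof.
move=> ac; have [_ oc _ _ _] := atlas_chart ac.
split=> // [i j|x|x].
- by apply: smooth_on_C2 => //; exact: gcomp_smooth.
- exact: gcomp_sym.
- exact: gcomp_nondeg.
Qed.

Lemma chart_at_atlas (R : realType) d (M : manifold R d) (p : M) :
  atlas (chart_at p).
Proof. exact: (s2valP (cid2 (atlas_cover p))). Qed.

Lemma chart_at_dom (R : realType) d (M : manifold R d) (p : M) :
  cdom (chart_at p) p.
Proof. exact: (s2valP' (cid2 (atlas_cover p))). Qed.

Lemma chart_at_img (R : realType) d (M : manifold R d) (p : M) :
  cimg (chart_at p) (cmap (chart_at p) p).
Proof. by exists p => //; exact: chart_at_dom. Qed.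

Lemma chart_atK (R : realType) d (M : manifold R d) (p : M) :
  cinv (chart_at p) (cmap (chart_at p) p) = p.
Proof.
have [_ _ cK _ _] := atlas_chart (chart_at_atlas p).
by rewrite cK//; exact: chart_at_dom.
Qed.

(** For a surface [k] is the Gaussian curvature at [q] and may vary with [q]; the argument takes
    place at one point, where this is as good as constant curvature. *)
Lemma fibre_curvature (R : realType) e (N : manifold R e)
    (gN : semi_riemannian N) (q : N) : (1 < e)%N ->
  ((2 < e)%N -> constant_curvature gN) ->
  exists k, forall u v w z,
    riem (gcomp gN (chart_at q)) (cmap (chart_at q) q) u v w z =
    k * gtensor (gcomp gN (chart_at q)) (cmap (chart_at q) q) u v w z.
Proof.
move=> e1 hN; have [e2|e3] := leqP e 2; last first.
  by have [k kE] := hN e3; exists k => u v w z; exact: kE.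
have eE : e = 2%N by apply/eqP; rewrite eqn_leq e2.
have lm := local_metric_chart gN (chart_at_atlas q).
have Dq := chart_at_img q.
(* Data whose types mention [e] are generalised so that [e] can be replaced by 2. *)
move: (gcomp gN _) (cimg _) (cmap _ q) lm Dq => g D x.
by clear -eE; subst e => lm Dq; exact: riem_dim2 lm Dq.
Qed.

Lemma warped_pseudosymmetric_at (R : realType) e (M : manifold R 2)
    (N : manifold R e) (gM : semi_riemannian M) (gN : semi_riemannian N)
    (F : M -> R) (p : M * N) (L : R) :
  smooth_fun F -> (forall q, 0 < F q) -> (1 < e)%N ->
  ((2 < e)%N -> constant_curvature gN) -> U_C gM gN F p ->
  (forall u1 u2 u3 u4 u v,
    RdotR (gW gM gN F p) (xW p) u1 u2 u3 u4 u v =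
    L * QgR (gW gM gN F p) (xW p) u1 u2 u3 u4 u v) <->
  Twarp gM F p = (- 2 * F p.1 * L) *: gbar gM p.
Proof.
move=> sF F0 e1 hN UC.
pose c1 := chart_at p.1; pose c2 := chart_at p.2.
pose g1 := gcomp gM c1; pose g2 := gcomp gN c2.
pose f y := F (cinv c1 y).
have lm1 : local_metric g1 (cimg c1).
  exact: local_metric_chart (chart_at_atlas _).
have lm2 : local_metric g2 (cimg c2).
  exact: local_metric_chart (chart_at_atlas _).
have fC : C2 (cimg c1) f.
  apply: smooth_on_C2; first exact: lm_open lm1.
  exact: sF (chart_at_atlas _).
have f_neq0 y : cimg c1 y -> f y != 0 by rewrite /f gt_eqF.
pose x1 := cmap c1 p.1; pose x2 := cmap c2 p.2.
have Dx1 : cimg c1 x1 := chart_at_img _.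
have Dx2 : cimg c2 x2 := chart_at_img _.
have fx : f x1 = F p.1 by rewrite /f /x1 chart_atK.
have xl : lsubmx (xW p) = x1 by rewrite row_mxKl.
have xr : rsubmx (xW p) = x2 by rewrite row_mxKr.
have Dx : cimg c1 (lsubmx (xW p)) /\ cimg c2 (rsubmx (xW p)) by rewrite xl xr.
have [K KE] := riem_dim2 lm1 Dx1.
have [k kE] := fibre_curvature p.2 e1 hN.
have cK := curv_op_constant (lm_unit lm1 Dx1) KE.
have ck := curv_op_constant (lm_unit lm2 Dx2) kE.
pose T := warp_tensor g1 f x1.
have Fp := gt_eqF (F0 p.1).
pose P := (- (2 * F p.1)^-1) *: T.
(* The coefficient of the fibre part in [curv_op_warped], divided by F because [H] is F times the
   fibre metric. *)
pose c := (k - 2^-1 * warp_dlog f (warp_grad g1 f x1) x1) / F p.1.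
have Ts : T^T = T.
  apply/matrixP => i j; rewrite mxE -[LHS](inner_delta (fun=> T) 0).
  rewrite -[RHS](inner_delta (fun=> T) 0).
  exact: (warp_form_sym lm1 fC).
have Ps : P^T = P by rewrite linearZ /= Ts.
pose H := F p.1 *: g2 x2.
have Hs : H^T = H by rewrite linearZ /= (lm_sym lm2 Dx2).
have uH : H \in unitmx.
  rewrite unitmxE detZ unitrM -unitmxE (lm_unit lm2 Dx2) andbT unitrX//.
  by rewrite unitfE Fp.
have Gs := lm_sym lm1 Dx1; have uG := lm_unit lm1 Dx1.
have gE : gW gM gN F p (xW p) = block_mx (g1 x1) 0 0 H.
  by rewrite /gW /warped_metric xl xr -/c1 -/c2 -/x1 -/(f x1) fx.
have cE u v w : curv_op (gW gM gN F p) (xW p) u v w = row_mx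
    (K *: (inner (fun=> g1 x1) 0 (lsubmx v) (lsubmx w) *: lsubmx u
           - inner (fun=> g1 x1) 0 (lsubmx u) (lsubmx w) *: lsubmx v)
     + (inner (fun=> H) 0 (rsubmx v) (rsubmx w)
          *: (lsubmx u *m (P *m invmx (g1 x1)))
        - inner (fun=> H) 0 (rsubmx u) (rsubmx w)
          *: (lsubmx v *m (P *m invmx (g1 x1)))))
    (c *: (inner (fun=> H) 0 (rsubmx v) (rsubmx w) *: rsubmx u
           - inner (fun=> H) 0 (rsubmx u) (rsubmx w) *: rsubmx v)
     + (inner (fun=> P) 0 (lsubmx v) (lsubmx w) *: rsubmx u
        - inner (fun=> P) 0 (lsubmx u) (lsubmx w) *: rsubmx v)).
  have HE a b : inner (fun=> H) 0 a b = F p.1 * inner g2 x2 a b.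
    by rewrite /inner /H -scalemxAr -scalemxAl mxE.
  have PE a b : inner (fun=> P) 0 a b =
      - (2 * F p.1)^-1 * warp_form g1 f x1 a b.
    by rewrite /inner /P -scalemxAr -scalemxAl mxE.
  have := curv_op_warped lm1 lm2 fC f_neq0 u v w Dx.
  rewrite /= xl xr cK ck fx => cw.
  rewrite -[LHS]/(curv_op _ (xW p) u v w) [LHS]cw !HE !PE /P -scalemxAl.
  rewrite -!scalemxAr /c /=.
  have F0' : F p.1 != 0 by rewrite Fp.
  rewrite -/T -[inner (fun=> g1 x1) 0 _ _]/(inner g1 x1 (lsubmx v) (lsubmx w)).
  rewrite -[inner (fun=> g1 x1) 0 _ _]/(inner g1 x1 (lsubmx u) (lsubmx w)).
  move: (lsubmx u *m _) (lsubmx v *m _) (warp_dlog _ _ _) => us vs dG.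
  move: (warp_form _ _ _ _ _) (warp_form _ _ _ _ _) => fv fu.
  move: (inner g1 _ _ _) (inner g1 _ _ _) => g1v g1u.
  move: (inner g2 _ _ _) (inner g2 _ _ _) => g2v g2u.
  move: (F p.1) F0' => Fp' F0'.
  by congr row_mx; apply/rowP => i; rewrite !mxE; field.
have weyl0 := weyl_block Gs Ps Hs uG uH e1 gE cE.
have F20 : 2 * F p.1 != 0 by rewrite mulf_neq0// Fp.
have PL : (Twarp gM F p = (- 2 * F p.1 * L) *: gbar gM p) <-> P = L *: g1 x1.
  rewrite -[Twarp gM F p]/T -[gbar gM p]/(g1 x1) /P; split=> [->|E].
    by rewrite scalerA; congr (_ *: _); field; rewrite Fp.
  rewrite -scalerA -E scalerA.
  have -> : - 2 * F p.1 * - (2 * F p.1)^-1 = 1 by field; rewrite Fp.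
  by rewrite scale1r.
rewrite PL; split=> [RL|PE]; last first.
  exact: (pseudosymmetric_block Gs Ps Hs uG gE cE).
have := pseudosymmetric_block_inv Gs Ps Hs uG uH e1 gE cE RL.
move=> /eqP; rewrite scaler_eq0 => /orP[|]; rewrite subr_eq0 => /eqP // tE.
by case: UC => u1 u2 u3 u4; exact: weyl0.
Qed.

Lemma metric_trace_scale (R : realType) d (g : 'rV[R]_d -> 'M[R]_d) x (a : R) :
  (g x)^T = g x -> g x \in unitmx -> metric_trace g x (a *: g x) = a * d%:R.
Proof.
move=> gs ug; rewrite /metric_trace sum_invmx_mul; last first.
  by rewrite linearZ /= gs.
by rewrite -scalemxAl mulmxV// linearZ /= mxtrace1.
Qed.

Theorem theorem5p3 (R : realType) (n : nat) (hn : (4 <= n)%N)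
    (M : manifold R 2) (N : manifold R (n - 2))
    (gM : semi_riemannian M) (gN : semi_riemannian N)
    (F : M -> R) (F_smooth : smooth_fun F) (F_pos : forall p, 0 < F p)
    (hN : (5 <= n)%N -> constant_curvature gN)
    (x : M * N) (U : set (M * N))
    (U_coord : coordinate_domain U) (U_x : U x)
    (U_sub : U `<=` U_S gM gN F `&` U_C gM gN F) :
  let L0 := fun p : M * N => - (trT gM F p / (4 * F p.1)) in
  [/\ (exists L : M * N -> R, pseudosymmetric_on gM gN F U L) <->
      (forall p, U p ->
        [/\ Hwarp gM F L0 p =
              2^-1 *: Twarp gM F p
              + (F p.1 * - (trT gM F p / (4 * F p.1))) *: gbar gM p,
            2^-1 *: Twarp gM F p
              + (F p.1 * - (trT gM F p / (4 * F p.1))) *: gbar gM p =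
              2^-1 *: (Twarp gM F p - (trT gM F p / 2) *: gbar gM p)
          & 2^-1 *: (Twarp gM F p - (trT gM F p / 2) *: gbar gM p) = 0]),
      (forall L : M * N -> R, pseudosymmetric_on gM gN F U L ->
        forall p, U p -> L p = L0 p)
    & (exists L : M * N -> R, pseudosymmetric_on gM gN F U L) <->
      (exists lam : M * N -> R, forall p, U p ->
        Twarp gM F p = lam p *: gbar gM p)].
Proof.
move=> L0.
have e1 : (1 < n - 2)%N by rewrite ltn_subRL.
have hN' : (2 < n - 2)%N -> constant_curvature gN by rewrite ltn_subRL.
(* No regularity is asked of [L], so the pointwise equivalence applies at each point of [U] with the
   number [L p]. *)
have pseudoE (L : M * N -> R) : pseudosymmetric_on gM gN F U L <->
    forall p, U p -> Twarp gM F p = (- 2 * F p.1 * L p) *: gbar gM p.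
  split=> PL p Up; have [_ UC] := U_sub p Up;
    apply/(warped_pseudosymmetric_at (L p) F_smooth F_pos e1 hN' UC);
    exact: PL.
(* The trace of the base metric is 2; with [a] equal to - 2 F L this determines L as - tr T / (4
   F). *)
have trE (p : M * N) a : Twarp gM F p = a *: gbar gM p -> trT gM F p = a * 2.
  move=> E; rewrite /trT E.
  have lm := local_metric_chart gM (chart_at_atlas p.1).
  have D := chart_at_img p.1.
  exact: (metric_trace_scale _ (lm_sym lm D) (lm_unit lm D)).
have F0 p : F p != 0 by rewrite gt_eqF.
have L0E (p : M * N) :
    (trT gM F p / 2) *: gbar gM p = (- 2 * F p.1 * L0 p) *: gbar gM p.
  by congr (_ *: _); rewrite /L0; field; rewrite F0.
split.
- split=> [[L /pseudoE PL] p Up|TL].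
    split=> //.
      rewrite scalerBr scalerA -scaleNr; congr (_ + _ *: _); field.
      by rewrite F0.
    have E := PL p Up; rewrite (trE p _ E) E mulfK ?pnatr_eq0// subrr.
    by rewrite scaler0.
  exists L0; apply/pseudoE => p /TL[_ _ /eqP].
  rewrite scaler_eq0 invr_eq0 pnatr_eq0 /= subr_eq0 => /eqP ->.
  exact: L0E.
- move=> L /pseudoE PL p /PL/trE E.
  by rewrite /L0 E; field; rewrite F0.
- split=> [[L /pseudoE PL]|[lam TL]].
    by exists (fun p => - 2 * F p.1 * L p).
  (* Solves lam = - 2 F L for L. *)
  exists (fun p => - lam p / (2 * F p.1)); apply/pseudoE => p /TL ->.
  by congr (_ *: _); field; rewrite F0.
Qed.
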